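(* Let $G$ be a finite group and $D$ an abelian $2$-group on which $G$ acts faithfully. Assume that $G$ has no nontrivial normal $2$-subgroups and that $G$ is generated by its solitary offenders on $D$. Then $G$ is a direct product of symmetric groups of odd degree, and $D/C_D(G)$ is a direct sum of natural modules.
   Context: All groups are finite. For a group $G$ acting faithfully on an abelian $2$-group $D$, an abelian $2$-subgroup $A\leq G$ is a best offender on $D$ if $|A||C_D(A)|\geq |B||C_D(B)|$ for every subgroup $B\leq A$. $\mathcal{A}_D(G)$ is the set of nontrivial best offenders in $G$ on $D$, and $\mathcal{A}_D(G)_2$ is the set of members of $\mathcal{A}_D(G)$ of order $2$. For a set $\mathcal{A}$ of subgroups of $G$ and $H\leq G$, $\mathcal{A}\cap H=\{A\in\mathcal{A}\mid A\leq H\}$. Solitary offenders: let $S$ be a Sylow $2$-subgroup of $G$, $\mathcal{A}=\mathcal{A}_D(G)_2$, $J=\langle\mathcal{A}\cap S\rangle$, and $T\in\mathcal{A}\cap S$. $T$ is solitary in $G$ relative to $S$ if there is a subgroup $L\leq G$ containing $T$ such that (S1) $L\cong S_3$; (S2) $J=T\times C_J(L)$ and $C_J(L)=\langle(\mathcal{A}\cap S)-\{T\}\rangle$; (S3) $D=[D,L]\times C_D(L)$ and $[D,L,C_J(L)]=1$. The solitary offenders of $G$ on $D$ are the subgroups of $G$ that are solitary in $G$ relative to some Sylow $2$-subgroup of $G$. A natural module for the symmetric group $S_m$ ($m\geq 3$) is the lone nontrivial irreducible composition factor of the standard permutation module for $S_m$ over the field with two elements (of dimension $m-1$ when $m$ is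 odd, and $m-2$ when $m$ is even). *)

(* Defs.v *)
From mathcomp Require Export all_boot all_algebra all_fingroup.
From mathcomp Require Export all_solvable all_character.

Set Implicit Arguments.
Unset Strict Implicit.
Unset Printing Implicit Defensive.

Local Open Scope group_scope.

Section Offenders.

(* An action of G on the group D by automorphisms; 'C_(|to)(A) is C_D(A). *)
Variables (aT rT : finGroupType) (G : {group aT}) (D : {group rT}).
Variable to : groupAction G D.

Definition best_offender (A : {group aT}) : bool :=
  [&& A \subset G, abelian A, 2.-group A &
      [forall B : {group aT}, (B \subset A) ==>
         (#|B| * #|'C_(|to)(B)| <= #|A| * #|'C_(|to)(A)|)%N]].

Definition best_offenders : {set {group aT}} :=
  [set A : {group aT} | best_offender A & A :!=: 1].

Definition best_offenders2 : {set {group aT}} :=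
  [set A in best_offenders | #|A| == 2%N].

Definition subgroups_in (AA : {set {group aT}}) (S : {set aT}) :
    {set {group aT}} :=
  [set A in AA | A \subset S].

Definition gen_groups (AA : {set {group aT}}) : {set aT} :=
  <<\bigcup_(A in AA) (A : {set aT})>>.

(* [X, A], computed in the semidirect product: [x, a] = x^-1 * x^a. *)
Definition act_comm (X : {set rT}) (A : {set aT}) : {set rT} :=
  <<[set x^-1 * to x a | x in X, a in A]>>.

Definition solitary_rel (S T : {group aT}) : bool :=
  let AS := subgroups_in best_offenders2 S in
  let J := gen_groups AS in
  (T \in AS) &&
  [exists L : {group aT},
    [&& L \subset G, T \subset L,
        L \isog [set: 'S_3],
        T \x 'C_J(L) == J, 'C_J(L) == gen_groups (AS :\ T),
        act_comm D L \x 'C_(|to)(L) == D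
      & act_comm (act_comm D L) 'C_J(L) == 1]].

Definition solitary (T : {group aT}) : bool :=
  [exists S : {group aT}, 2.-Sylow(G) S && solitary_rel S T].

Definition solitary_offenders : {set {group aT}} :=
  [set T : {group aT} | solitary T].

End Offenders.

Section NaturalModules.

Lemma perm_mx_is_repr (m : nat) :
  mx_repr [set: 'S_m] (fun s : 'S_m => perm_mx s : 'M['F_2]_m).
Proof. by split=> [|s t _ _]; [apply: perm_mx1 | apply: perm_mxM]. Qed.

(* The standard permutation module; e_i * perm_mx s = e_(s i). *)
Definition perm_repr (m : nat) : mx_representation 'F_2 [set: 'S_m] m :=
  MxRepresentation (perm_mx_is_repr m).

(* The lone nontrivial composition factor of perm_repr m: factors of a full
   composition series (last term 1%:M) are irreducible, and by Jordan-Hoelder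
   the choice of series is immaterial. *)
Definition natural_repr (m n : nat)
    (rho : mx_representation 'F_2 [set: 'S_m] n) : Prop :=
  exists (U : seq 'M['F_2]_m)
         (compU : mx_composition_series (perm_repr m) U) (i : 'I_(size U)),
    [/\ (last 0%R U :=: (1%:M)%R)%MS,
        mx_rsim rho (series_repr i compU)
      & rker rho != [set: 'S_m]].

(* V, acted on by H via to, is a natural module for the symmetric group S_m,
   H being identified with S_m by the isomorphism phi; f is an isomorphism
   from V to the underlying additive group of the module of rho. *)
Definition natural_module (aT rT : finGroupType) (A : {set aT})
    (to : action A rT) (H : {group aT}) (V : {group rT}) (m : nat) : Prop :=
  (2 < m)%N /\
  exists phi : {morphism [set: 'S_m] >-> aT},
    isom [set: 'S_m] H phi /\
    exists (n : nat) (rho : mx_representation 'F_2 [set: 'S_m] n)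
           (f : {morphism V >-> 'rV['F_2]_n}),
      [/\ natural_repr rho,
          isom V [set: 'rV['F_2]_n] f
        & {in V, forall v (s : 'S_m), to v (phi s) \in V /\
             f (to v (phi s)) = (f v *m rho s)%R}].

End NaturalModules.

(* Main.v *)
(**
A solitary offender is generated by an involution t acting on D as a
transvection d |-> d * z^(f d), where f : D -> F_2 is a homomorphism and z is
the center of t.  By (S1) and (S2), some conjugate u of t does not commute with
t, but commutes with every other transvection of a suitable Sylow 2-subgroup
containing t.

Weak closure of the subgroup generated by the transvections of a Sylow
2-subgroup shows that t is the only transvection with its center, and the only
one with its axis.  Hence the involutions considered form a set of
3-transpositions, on which the pairing f_s(z_t) is symmetric, and Sylow's
theorem in C_G(t) gives every member of every commuting subset C a partner:
an involution of the same kind which commutes with all of C but that member.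
In particular the centers of a commuting set are linearly independent.

Consequently an involution fails to commute with at most two members of a
commuting set.  This forces a maximal family of transpositions of a symmetric
group inside a conjugacy class to be the whole class, while applying the
partner property to a perfect matching shows that the degree is odd.  Distinct
classes commute, and O_2(G) = 1 gives Z(G) = 1, so G is the direct product of
the symmetric groups generated by the classes.  Since the degrees are odd, the
pairing is nondegenerate on the span of the centers in a class, which is thus
a direct factor of D modulo C_D(G), isomorphic to the even-weight submodule of
the permutation module.
*)

Require Import Defs.
From mathcomp Require Import zify.

Set Implicit Arguments.
Unset Strict Implicit.
Unset Printing Implicit Defensive.

Local Open Scope group_scope.

(** * Transvections on [D], their centers and axes *)

Section Transvections.

Variables (aT rT : finGroupType) (G : {group aT}) (D : {group rT}).
Variable to : groupAction G D.

Definition moves (t : aT) (d : rT) : bool := to d t != d.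

Definition transvections : {set aT} :=
  [set t in G | (#[t] == 2%N) && (#|'C_(|to)[t]| * 2 == #|D|)%N].

(** For a transvection all moved elements give the same commutator ([transvection_act]), and
    faithfulness provides one ([moves_ex]), so neither the choice nor the default 1 matters. *)
Definition tcenter (t : aT) : rT :=
  let d := odflt 1 [pick d in D | moves t d] in d^-1 * to d t.

Hypotheses (abD : abelian D) (faithG : [faithful G, on D | to]).

Local Notation R := transvections.

Lemma act_stable d g : g \in G -> (to d g \in D) = (d \in D).
Proof. by move=> Gg; apply: gact_stable. Qed.

Lemma gact_mul x d e : x \in G -> d \in D -> e \in D -> to (d * e) x = to d x * to e x.
Proof. by move=> Gx Dd De; apply: gactM. Qed.

Lemma act_comp d g h : g \in G -> h \in G -> to d (g * h) = to (to d g) h.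
Proof. by move=> Gg Gh; rewrite actMin. Qed.

Lemma mulDC : {in D &, commutative mulg}.
Proof. by move=> x y Dx Dy; apply: (centsP abD). Qed.

Lemma faithful_eq g h :
  g \in G -> h \in G -> (forall d, d \in D -> to d g = to d h) -> g = h.
Proof.
move=> Gg Gh E; apply/eqP; rewrite eq_mulgV1; apply/eqP.
have: g * h^-1 \in 'C_G(D | to).
  have Ggh : g * h^-1 \in G by rewrite groupM ?groupV.
  rewrite !inE Ggh /=; apply/subsetP=> d Dd; rewrite inE; apply/eqP.
  by rewrite act_comp ?groupV // E // -act_comp ?groupV // mulgV act1.
by move/(subsetP faithG)/set1P.
Qed.

Lemma transvectionsG t : t \in R -> t \in G.
Proof. by rewrite inE; case/and3P. Qed.

Lemma transvection_ord t : t \in R -> #[t] = 2%N.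
Proof. by rewrite inE; case/and3P=> _ /eqP. Qed.

Lemma transvection_sq t : t \in R -> t * t = 1.
Proof. by move/transvection_ord=> ot; have := expg_order t; rewrite ot expgS expg1. Qed.

Lemma transvectionV t : t \in R -> t^-1 = t.
Proof.
by move=> /transvection_sq t2; apply/eqP; rewrite eq_sym eq_mulgV1 invgK t2.
Qed.

Lemma gacentP t d : t \in G -> d \in D -> (d \in 'C_(|to)[t]) = ~~ moves t d.
Proof.
move=> Gt Dd; rewrite gacent1E // inE Dd /= /moves negbK.
by apply/afix1P/eqP.
Qed.

Lemma moves_setD t : t \in G -> D :\: 'C_(|to)[t] = [set d in D | moves t d].
Proof.
move=> Gt; apply/setP=> d; rewrite in_setD inE andbC.
by case Dd: (d \in D) => //=; rewrite gacentP ?negbK.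
Qed.

Lemma gacent_sub A : 'C_(|to)(A) \subset D.
Proof. exact: subsetIl. Qed.

Lemma moves_coset t x :
  t \in R -> x \in D -> moves t x -> x *: 'C_(|to)[t] = [set d in D | moves t d].
Proof.
move=> Rt Dx mx; have Gt := transvectionsG Rt.
rewrite -moves_setD //; apply/eqP; rewrite eqEcard; apply/andP; split.
  apply/subsetP=> _ /lcosetP[y Cy ->].
  have Dy := subsetP (gacent_sub _) _ Cy.
  have Dxy := groupM Dx Dy.
  by rewrite inE Dxy andbT groupMr // gacentP ?negbK.
move: Rt; rewrite inE => /and3P[_ _ /eqP oD].
rewrite card_lcoset cardsD (setIidPr (gacent_sub _)) -oD.
by rewrite muln2 -addnn addnK.
Qed.

(** The fixed points of [t] have index 2, so the moved elements form a single coset and [moves t] is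
    the quotient map from [D] to F_2, with [(+)] as addition. *)
Lemma movesM t : t \in R -> {in D &, {morph moves t : x y / x * y >-> x (+) y}}.
Proof.
move=> Rt x y Dx Dy; have Gt := transvectionsG Rt.
have [mx|nx] := boolP (moves t x); last first.
  move: nx; rewrite /moves negbK gact_mul // => /eqP->.
  by rewrite (inj_eq (mulgI x)).
have := moves_coset Rt Dx mx => /setP/(_ (x * y)).
by rewrite mem_lcoset mulKg gacentP // inE groupM //= => <-.
Qed.

(** Two moved elements differ by a fixed one, so their commutators with [t] agree. *)
Lemma transvection_act t d :
  t \in R -> d \in D -> to d t = d * tcenter t ^+ moves t d.
Proof.
move=> Rt Dd; have Gt := transvectionsG Rt.
have [md|nd] := boolP (moves t d); last first.
  by move: nd; rewrite /moves negbK expg0 mulg1 => /eqP.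
rewrite expg1 /tcenter; case: pickP => [x /andP[Dx mx]|/(_ d)]; last first.
  by rewrite Dd md.
have: d \in x *: 'C_(|to)[t] by rewrite moves_coset // inE Dd.
case/lcosetP=> y Cy ->{d Dd md}.
have Dy := subsetP (gacent_sub _) _ Cy.
move: Cy; rewrite gacentP // negbK => /eqP ty.
rewrite gact_mul // ty /=.
have Dxt : to x t \in D by rewrite act_stable.
rewrite !mulgA -(mulDC Dy Dx) -[y * x * _]mulgA mulgV mulg1.
by rewrite (mulDC Dy Dxt).
Qed.

Lemma moves_ex t : t \in R -> exists2 d, d \in D & moves t d.
Proof.
move=> Rt; have Gt := transvectionsG Rt.
case: (pickP [pred d in D | moves t d]) => [d /= /andP[]|n]; first by exists d.
have /eqP := transvection_ord Rt; rewrite (_ : t = 1) ?order1 //.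
apply: faithful_eq => // d Dd; rewrite act1; have:= n d; rewrite /= Dd /=.
by move/negbFE/eqP.
Qed.

Lemma centerE t d : t \in R -> d \in D -> moves t d -> tcenter t = d^-1 * to d t.
Proof. by move=> Rt Dd md; rewrite transvection_act // md mulKg. Qed.

Lemma centerD t : t \in R -> tcenter t \in D.
Proof.
move=> Rt; have [d Dd md] := moves_ex Rt.
by rewrite (centerE Rt Dd md) groupM ?groupV // act_stable ?transvectionsG.
Qed.

Lemma center_neq1 t : t \in R -> tcenter t != 1.
Proof.
move=> Rt; have [d Dd md] := moves_ex Rt.
rewrite (centerE Rt Dd md) eq_sym -(inj_eq (mulgI d)) mulg1 mulKVg eq_sym.
exact: md.
Qed.

(** As [t] is an involution, it moves [d] and [to d t] alike, and the two contributions cancel in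
    [d^-1 * to d t]. *)
Lemma moves_center t : t \in R -> moves t (tcenter t) = false.
Proof.
move=> Rt; have Gt := transvectionsG Rt; have [d Dd md] := moves_ex Rt.
rewrite (centerE Rt Dd md) movesM ?groupV ?act_stable //.
suff -> : moves t (to d t) = moves t d.
  have := movesM Rt (groupVr Dd) Dd; rewrite mulVg => <-.
  by rewrite /moves gact1 ?eqxx.
rewrite /moves -act_comp // transvection_sq // act1 eq_sym.
by [].
Qed.

(** Applying [t] twice to a moved [d] multiplies it by the square of the center, since [t] fixes its
    center. *)
Lemma center_sq t : t \in R -> tcenter t * tcenter t = 1.
Proof.
move=> Rt; have Gt := transvectionsG Rt; have [d Dd md] := moves_ex Rt.
have E: to (to d t) t = d by rewrite -act_comp // transvection_sq // act1.
move: E; rewrite (transvection_act Rt Dd) md expg1 gact_mul ?centerD //.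
rewrite (transvection_act Rt Dd) md expg1.
have := moves_center Rt; rewrite /moves => /negbFE/eqP ->.
by rewrite -mulgA => /eqP; rewrite eq_sym -{1}[d]mulg1 (inj_eq (mulgI d)) => /eqP.
Qed.

Lemma moves1 t : t \in G -> moves t 1 = false.
Proof. by move=> Gt; rewrite /moves gact1 ?eqxx. Qed.

Lemma movesJ t g d : t \in G -> g \in G -> moves (t ^ g) (to d g) = moves t d.
Proof.
move=> Gt Gg; rewrite /moves -act_comp ?groupJ // conjgE !mulgA mulgV mul1g.
rewrite act_comp //; apply/idP/idP; apply: contraNN => /eqP.
  by move->.
by move/(act_inj to g) ->.
Qed.

Lemma transvectionJ t g : g \in G -> (t ^ g \in R) = (t \in R).
Proof.
move=> Gg; rewrite !inE groupJr // orderJ; case Gt: (t \in G) => //=.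
case: eqP => //= _; congr (_ * 2 == _)%N.
rewrite -[RHS](card_imset _ (act_inj to g)); apply: eq_card => d.
apply/idP/imsetP => [Cd|[e Ce ->]].
  have Dd := subsetP (gacent_sub _) _ Cd.
  exists (to d g^-1); last by rewrite -act_comp ?groupV // mulVg act1.
  rewrite gacentP ?act_stable ?groupV // -(@movesJ t g) //.
  by rewrite -act_comp ?groupV // mulVg act1 -gacentP ?groupJ.
have De := subsetP (gacent_sub _) _ Ce.
by rewrite gacentP ?groupJ ?act_stable // movesJ // -gacentP.
Qed.

Lemma centerJ t g : t \in R -> g \in G -> tcenter (t ^ g) = to (tcenter t) g.
Proof.
move=> Rt Gg; have Gt := transvectionsG Rt; have [d Dd md] := moves_ex Rt.
have mg : moves (t ^ g) (to d g) by rewrite movesJ.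
rewrite (centerE _ _ mg) ?act_stable ?transvectionJ //.
rewrite (centerE Rt Dd md) gact_mul ?groupV ?act_stable //.
rewrite gactV // -!act_comp ?groupJ // conjgE !mulgA mulgV mul1g.
by [].
Qed.

Lemma transvection_eq s t : s \in R -> t \in R ->
  tcenter s = tcenter t -> {in D, moves s =1 moves t} -> s = t.
Proof.
move=> Rs Rt ez em; apply: faithful_eq; rewrite ?transvectionsG // => d Dd.
by rewrite !transvection_act // ez em.
Qed.

Lemma commute_conj (s t : aT) : commute s t <-> t ^ s = t.
Proof. by split=> [c|/conjg_fixP/commgP//]; apply/conjg_fixP/commgP. Qed.

Lemma commute_moves s t : s \in R -> t \in R -> commute s t ->
  moves s (tcenter t) = false.
Proof.
move=> Rs Rt /commute_conj E; by rewrite /moves -centerJ ?transvectionsG // E eqxx.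
Qed.

(** When each involution fixes the center of the other, both composites multiply [d] by the same
    product of powers of the two centers. *)
Lemma moves_commute s t : s \in R -> t \in R ->
  moves s (tcenter t) = false -> moves t (tcenter s) = false -> commute s t.
Proof.
move=> Rs Rt st ts; have [Gs Gt] := (transvectionsG Rs, transvectionsG Rt).
apply: faithful_eq; rewrite ?groupM // => d Dd; rewrite !act_comp //.
have F x y : x \in R -> y \in R -> moves x (tcenter y) = false ->
   to (to d y) x = d * tcenter x ^+ moves x d * tcenter y ^+ moves y d.
  move=> Rx Ry xy; rewrite [to d y]transvection_act // gact_mul ?groupX ?transvectionsG ?centerD //.
  rewrite transvection_act //; congr (_ * _); case: (moves y d); rewrite ?expg0 ?expg1.
    by move/negbFE/eqP: xy.
  by rewrite gact1 ?transvectionsG.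
rewrite !F // -!mulgA; congr (_ * _).
by rewrite mulDC ?groupX ?centerD.
Qed.

End Transvections.

(** * From solitary offenders to partnered transvections *)

Section Partnered.

Variables (aT rT : finGroupType) (G : {group aT}) (D : {group rT}).
Variable to : groupAction G D.

Local Notation moves := (moves to).
Local Notation tcenter := (tcenter to).
Local Notation R := (transvections to).

(** [u] comes from the subgroup [L] of (S1), as a conjugate of [t] not commuting with it; the last
    clause is the trace of (S2) on the transvections of [S]. *)
Definition partnered : {set aT} :=
  [set t in R | [exists S : {group aT}, exists u in t ^: G,
    [&& 2.-Sylow(G) S, t \in S, moves u (tcenter t), moves t (tcenter u)
      & [forall r in R, (r \in S) && (r != t) ==>
          (r \in 'C[t]) && (r \in 'C[u])]]]].

Hypotheses (abD : abelian D) (faithG : [faithful G, on D | to]).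

Local Notation TT := partnered.

(** The only proper subgroup of [T] is trivial, so the offender inequality reads |D| <= 2 |C_D(T)|.
    Faithfulness makes C_D(T) proper in [D], so the index is exactly 2. *)
Lemma offender2P (T : {group aT}) :
  reflect (exists2 t, t \in R & T :=: <[t]>) (T \in best_offenders2 to).
Proof.
apply: (iffP idP) => [|[t Rt defT]].
  rewrite !inE => /andP[/andP[/and4P[sTG _ _ offT] ntT] oT].
  have pr_T : prime #|T| by rewrite (eqP oT).
  have /cyclicP[t defT] := prime_cyclic pr_T.
  have Gt : t \in G by rewrite (subsetP sTG) // defT cycle_id.
  exists t => //; rewrite inE Gt /order -defT oT /= eqn_leq; apply/andP; split.
    have pC : 'C_(|to)[t] \proper D.
      rewrite properEneq gacent_sub andbT; apply: contraNneq ntT => ED.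
      rewrite defT cycle_eq1; apply/eqP/(faithful_eq faithG) => // d Dd.
      move: Dd; rewrite -{1}ED => Cd; have Dd := subsetP (gacent_sub _ _) _ Cd.
      by move: Cd; rewrite gacentP // negbK act1 => /eqP.
    rewrite -(Lagrange (proper_sub pC)) leq_pmul2l ?cardG_gt0 //.
    by rewrite indexg_gt1 proper_subn.
  move/forallP/(_ 1%G)/implyP/(_ (sub1G _)): offT.
  rewrite (eqP oT) cards1 mul1n /= gacent1 [X in 'C_(|to)(X)]defT gacent_cycle //.
  by rewrite mulnC.
have Gt := transvectionsG Rt; have ot := transvection_ord Rt.
have oT : #|T| = 2%N by rewrite defT -ot.
rewrite !inE oT eqxx andbT -cardG_gt1 oT andbT; apply/and4P; split.
- by rewrite defT cycle_subG.
- by rewrite defT cycle_abelian.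
- by rewrite /pgroup oT.
apply/forallP=> B; apply/implyP=> sBT.
have [->|] := eqVneq (B : {set aT}) T; first by rewrite oT.
have: #|B| %| 2 by rewrite -oT cardSg.
rewrite dvdn_divisors // !inE => /orP[o1|o2]; last first.
  by rewrite eqEcard sBT (eqP o2) oT.
move=> _; have -> : B :=: 1 by apply/eqP; rewrite trivg_card1.
rewrite oT cards1 mul1n gacent1 defT gacent_cycle // mulnC.
by move: Rt; rewrite inE => /and3P[_ _ /eqP->].
Qed.

Lemma partneredP t :
  reflect [/\ t \in R & exists (S : {group aT}) (u : aT), u \in t ^: G /\
     [/\ 2.-Sylow(G) S, t \in S, moves u (tcenter t), moves t (tcenter u)
      & forall r, r \in R -> r \in S -> r != t -> commute r t /\ commute r u]]
   (t \in TT).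
Proof.
rewrite [t \in TT]inE; apply: (iffP andP) => [[Rt /existsP[S /exists_inP[u tu]]]|].
  case/and5P=> ? ? ? ? /forall_inP H.
  split=> //; exists S, u; split=> //; split=> // r Rr Sr nrt; have := H r Rr.
  by rewrite Sr nrt /= => /andP[/cent1P ? /cent1P ?].
case=> Rt [S [u [tu [? ? ? ? H]]]]; split=> //.
apply/existsP; exists S; apply/exists_inP; exists u => //; apply/and5P; split=> //.
apply/forall_inP=> r Rr; apply/implyP=> /andP[Sr nrt].
by have [? ?] := H r Rr Sr nrt; apply/andP; split; apply/cent1P.
Qed.

Lemma partneredR t : t \in TT -> t \in R.
Proof. by case/partneredP. Qed.

Lemma partneredG t : t \in TT -> t \in G.
Proof. by move/partneredR/transvectionsG. Qed.

Lemma partneredJ t g : g \in G -> t \in TT -> t ^ g \in TT.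
Proof.
move=> Gg /partneredP[Rt [S [u [tu [sylS St ut tu' H]]]]].
have Gt := transvectionsG Rt.
have Ru : u \in R.
  by case/imsetP: tu => h Gh ->; rewrite transvectionJ.
have Gu := transvectionsG Ru.
apply/partneredP; split; first by rewrite transvectionJ.
exists (S :^ g)%G, (u ^ g); split.
  rewrite classGidl //; case/imsetP: tu => h Gh ->.
  by rewrite -conjgM; apply/imsetP; exists (h * g); rewrite ?groupM.
split; first 1 last.
- by rewrite memJ_conjg.
- by rewrite centerJ // movesJ.
- by rewrite centerJ // movesJ.
- move=> r Rr Sr nrt; have [] := H (r ^ g^-1).
  + by rewrite transvectionJ ?groupV.
  + by rewrite -mem_conjg.
  + by apply: contraNneq nrt => <-; rewrite conjgKV.
  + move=> c1 c2; split; rewrite -[r](conjgKV g) /commute -!conjMg; congr (_ ^ _) => //.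
- by rewrite pHallJ.
Qed.

(* A Sylow 2-subgroup of a group isomorphic to S_3 has order 2, so two
   commuting involutions of L coincide. *)
Lemma commuting_involutions_eq (L : {group aT}) (s t : aT) :
  #|L| = 6 -> s \in L -> t \in L -> #[s] = 2%N -> #[t] = 2%N -> commute s t -> s = t.
Proof.
move=> oL Ls Lt os ot cst.
have cst' : <[s]> \subset 'C(<[t]>).
  by rewrite cent_cycle cycle_subG; apply/cent1P; apply: commute_sym.
have sL : <[s]> * <[t]> \subset L by rewrite mul_subG ?cycle_subG.
have := mul_cardG <[s]> <[t]>.
have eqG := cent_joinEl cst'.
have : #|<[s]> <*> <[t]>| %| 6 by rewrite -oL cardSg // join_subG !cycle_subG Ls.
rewrite -!orderE os ot -eqG.
have : #|<[s]> :&: <[t]>| %| 2 by rewrite -os orderE cardSg ?subsetIl.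
rewrite dvdn_divisors // !inE => /orP[] /eqP oI dvd6 E.
  by move: E dvd6; rewrite oI muln1 => <-.
have EI : <[s]> :&: <[t]> = <[t]>.
  by apply/eqP; rewrite eqEcard subsetIr oI -orderE ot.
have : t \in <[s]> by rewrite -cycle_subG -EI subsetIl.
case/cycleP=> i ti; have := ltn_pmod i (isT : 0 < 2)%N.
have : t != 1 by rewrite -order_gt1 ot.
rewrite ti -expg_mod_order os; case: (i %% 2) => [|[|]] //=.
by rewrite expg0 eqxx.
Qed.

Lemma third_point m (i j : 'I_m) : (2 < m)%N -> exists2 k, k != i & k != j.
Proof.
move=> m3; suff /existsP[k] : [exists k, k \notin [set i; j]].
  by rewrite !inE negb_or => /andP[]; exists k.
apply: contraLR m3 => /existsPn H; rewrite -leqNgt.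
rewrite -[m in (m <= _)%N](card_ord m) -cardsT.
have -> : [set: 'I_m] = [set i; j].
  by apply/setP=> k; rewrite inE; have:= H k; rewrite negbK => ->.
by rewrite cards2; case: (_ != _).
Qed.

(** Conjugating by the transposition of [s i] with a third letter keeps [i] but changes its
    image. *)
Lemma perm_conj_neq m (s : 'S_m) : (2 < m)%N -> s != 1 -> exists r : 'S_m, s ^ r != s.
Proof.
move=> m3 nt_s.
have [i si] : exists i, s i != i.
  apply/existsP; apply: contraR nt_s => /existsPn H; apply/eqP/permP=> i.
  by rewrite perm1; apply/eqP; have:= H i; rewrite negbK.
have [k ki ks] := third_point i (s i) m3.
exists (tperm (s i) k); apply/eqP=> E.
have := permJ s (tperm (s i) k) i; rewrite E tpermL tpermD // 1?eq_sym //.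
by move/eqP; rewrite eq_sym (negPf ks).
Qed.

(** Some conjugate [u] of [t] inside [L] differs from [t], and distinct involutions of [L] do not
    commute. By (S2) every other transvection of [S] lies in C_J(L), hence commutes with both [t]
    and [u]. *)
Lemma solitary_partnered (T : {group aT}) :
  T \in solitary_offenders to -> exists2 t, t \in TT & T :=: <[t]>.
Proof.
rewrite inE => /existsP[S /andP[sylS /andP[]]].
set AS := subgroups_in _ S; rewrite inE => /andP[/offender2P[t Rt defT] sTS].
case/existsP=> L /and5P[sLG sTL isoL _ /andP[/eqP defC _]].
exists t => //; have Gt := transvectionsG Rt.
have ot := transvection_ord Rt.
have Lt : t \in L by rewrite (subsetP sTL) // defT cycle_id.
have St : t \in S by rewrite (subsetP sTS) // defT cycle_id.
have oL : #|L| = 6 by rewrite (card_isog isoL) cardsT card_Sn.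
have [g Lg ntg] : exists2 g, g \in L & t ^ g != t.
  have [f injf imf] := isogP isoL.
  have : f t != 1.
    by rewrite -order_gt1 order_injm // ot.
  case/perm_conj_neq=> // r ntr.
  have : r \in f @* L by rewrite imf inE.
  case/morphimP=> g _ Lg fg; exists g => //.
  by apply: contraNneq ntr => E; rewrite fg -morphJ // E.
have Gg := subsetP sLG _ Lg; set u := t ^ g in ntg *.
have Ru : u \in R by rewrite transvectionJ.
have Lu : u \in L by rewrite groupJ.
have invL : forall x y, x \in R -> y \in R -> x \in L -> y \in L -> commute x y -> x = y.
  move=> x y Rx Ry Lx Ly.
  exact: (commuting_involutions_eq oL Lx Ly (transvection_ord Rx) (transvection_ord Ry)).
(* If [y] fixed the center of [x], then [x] and [x ^ y] would share a center and hence commute;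
   inside [L] this forces [x ^ y = x], so [x] and [y] would commute. *)
have mv : forall x y, x \in R -> y \in R -> x \in L -> y \in L -> x != y ->
    moves y (tcenter x).
  move=> x y Rx Ry Lx Ly nxy; apply: contraT => fy.
  have Gy := transvectionsG Ry.
  have Exy : tcenter (x ^ y) = tcenter x.
    by rewrite centerJ //; apply/eqP; apply: negbNE.
  have Rxy : x ^ y \in R by rewrite transvectionJ.
  have cxy : commute x (x ^ y).
    apply: (moves_commute abD faithG Rx Rxy). by rewrite Exy moves_center.
    by rewrite -Exy moves_center.
  have Exx := invL _ _ Rx Rxy Lx (groupJ Lx Ly) cxy.
  case/eqP: nxy; apply: invL => //; apply/commute_sym/commute_conj.
  by rewrite -Exx.
apply/partneredP; split=> //; exists S, u; split.
  by apply/imsetP; exists g.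
split=> //; try by apply: mv => //; rewrite eq_sym.
move=> r Rr Sr nrt.
have : <[r]>%G \in AS :\ T.
  rewrite in_setD1 /AS inE; apply/and3P; split; last by rewrite cycle_subG.
  - apply: contraNneq nrt => /(congr1 (@gval _)) /= E.
    have : r \in <[t]> by rewrite -defT -E cycle_id.
    case/cycleP=> i ri; have := ltn_pmod i (isT : 0 < 2)%N.
    have : r != 1 by rewrite -order_gt1 (transvection_ord Rr).
    rewrite ri -expg_mod_order ot; case: (i %% 2) => [|[|]] //=.
    by rewrite expg0 eqxx.
  - by apply/offender2P; exists r.
move=> AS_r; have : r \in 'C_(gen_groups AS)(L).
  by rewrite defC mem_gen //; apply/bigcupP; exists <[r]>%G => //; apply: cycle_id.
by case/setIP=> _ /centP cL; split; apply: cL.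
Qed.

End Partnered.

(** * Weak closure, symmetry of the pairing, and partners in commuting sets *)

Section Fusion.

Variables (aT rT : finGroupType) (G : {group aT}) (D : {group rT}).
Variable to : groupAction G D.

Local Notation moves := (moves to).
Local Notation tcenter := (tcenter to).
Local Notation R := (transvections to).
Local Notation TT := (partnered to).

Hypotheses (abD : abelian D) (faithG : [faithful G, on D | to]).

(** A conjugate of [P] lies in [S], so [<<R :&: P>>] is conjugate into [<<R :&: S>>]. The latter is
    contained in the former, and comparing orders gives equality. *)
Lemma transvections_weakly_closed (S P : {group aT}) :
  2.-Sylow(G) S -> P \subset G -> 2.-group P -> <<R :&: S>> \subset P ->
  R :&: P \subset <<R :&: S>>.
Proof.
move=> sylS sPG pP sJP.
have [g Gg sPS] := Sylow_Jsub sylS sPG pP.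
have RJ : R :^ g = R.
  by apply/setP=> r; rewrite mem_conjg transvectionJ ?groupV.
have sub1 : <<R :&: P>> :^ g \subset <<R :&: S>>.
  rewrite -genJ genS // conjIg RJ setIS //.
have sub2 : <<R :&: S>> \subset <<R :&: P>>.
  by rewrite genS // subsetI subsetIl (subset_trans _ sJP) // subset_gen.
have /eqP -> : <<R :&: S>> == <<R :&: P>>.
  by rewrite eqEcard sub2 -(cardJg <<R :&: P>> g) subset_leq_card.
exact: subset_gen.
Qed.

Lemma commuting_pgroup (A : {set aT}) :
  A \subset R -> {in A &, forall x y, commute x y} ->
  abelian <<A>> /\ 2.-group <<A>>.
Proof.
move=> sAR cA.
have abA : abelian <<A>>.
  rewrite abelian_gen; apply/centsP => x Ax y Ay; exact: cA.
split=> //.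
have sA : <<A>> \subset 'O_2(<<A>>).
  rewrite gen_subG; apply/subsetP=> a Aa.
  rewrite (mem_normal_Hall (nilpotent_pcore_Hall _ (abelian_nil abA))) ?pcore_normal //.
    by rewrite /p_elt (transvection_ord (subsetP sAR _ Aa)).
  exact: mem_gen.
exact: pgroupS sA (pcore_pgroup _ _).
Qed.

(** [A] and [R :&: S] together generate a 2-group, to which weak closure applies. *)
Lemma sub_Sylow_of_normalized (S : {group aT}) (A : {set aT}) :
  2.-Sylow(G) S -> A \subset R -> {in A &, forall x y, commute x y} ->
  R :&: S \subset 'N(A) -> A \subset S.
Proof.
move=> sylS sAR cA nA; have [_ pA] := commuting_pgroup sAR cA.
have sRG : R \subset G by apply/subsetP=> r /transvectionsG.
have nJ : <<R :&: S>> \subset 'N(<<A>>) by rewrite gen_subG (subset_trans nA) ?norms_gen.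
have sJS : <<R :&: S>> \subset S by rewrite gen_subG subsetIr.
apply: subset_trans sJS.
have pP : 2.-group (<<A>> <*> <<R :&: S>>).
  rewrite norm_joinEr // pgroupM pA /=.
  by apply: pgroupS (pHall_pgroup sylS); rewrite gen_subG subsetIr.
have := transvections_weakly_closed sylS _ pP (joing_subr _ _).
rewrite join_subG !gen_subG (subset_trans sAR) // (subset_trans (subsetIl _ _)) //.
move=> /(_ isT); apply: subset_trans.
by rewrite subsetI sAR (subset_trans (subset_gen _) (joing_subl _ _)).
Qed.

(** The transvections with the center of [t] commute pairwise, and those of [S] permute them because
    they fix that center; so they all lie in [S]. One different from [t] would commute with [u], but
    [u] moves their common center. *)
Lemma center_inj t r : t \in TT -> r \in R -> tcenter r = tcenter t -> r = t.
Proof.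
case/partneredP=> // Rt [S [u [tu [sylS St ut tu' H]]]] Rr ert.
have Ru : u \in R by case/imsetP: tu => h Gh ->; rewrite transvectionJ.
pose A := [set r in R | tcenter r == tcenter t].
have AP x : reflect (x \in R /\ tcenter x = tcenter t) (x \in A).
  by rewrite [x \in A]inE; apply: (iffP andP) => -[Rx /eqP].
have : A \subset S.
  apply: sub_Sylow_of_normalized => //.
  - by apply/subsetP=> x /AP[].
  - move=> x y /AP[Rx ex] /AP[Ry ey].
    have E : tcenter x = tcenter y by rewrite ex ey.
    apply: (moves_commute abD faithG Rx Ry); first by rewrite -E moves_center.
    by rewrite E moves_center.
  apply/subsetP=> s /setIP[Rs Ss]; have Gs := transvectionsG Rs.
  rewrite inE; apply/subsetP=> _ /imsetP[x /AP[Rx ex] ->].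
  apply/AP; rewrite transvectionJ // centerJ // ex; split=> //.
  have [->|nst] := eqVneq s t; first by apply/eqP/negbFE/moves_center.
  have [c _] := H s Rs Ss nst.
  by apply/eqP/negbFE/commute_moves.
move/subsetP/(_ r); have -> : r \in A by apply/AP.
move/(_ isT) => Sr; apply/eqP; apply: contraT => nrt; have [_ c] := H r Rr Sr nrt.
by move: ut; rewrite -ert (commute_moves abD faithG Ru Rr) // commute_sym.
Qed.

(** Dual to [center_inj]: the transvections with the axis of [t] all lie in [S], and each of them
    moves the center of [u], so none but [t] can occur. *)
Lemma axis_inj t r : t \in TT -> r \in R -> {in D, moves r =1 moves t} -> r = t.
Proof.
case/partneredP=> // Rt [S [u [tu [sylS St ut tu' H]]]] Rr ert.
have Ru : u \in R by case/imsetP: tu => h Gh ->; rewrite transvectionJ.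
have Gt := transvectionsG Rt.
pose A := [set r in R | [forall d in D, moves r d == moves t d]].
have AP x : reflect (x \in R /\ {in D, moves x =1 moves t}) (x \in A).
  rewrite [x \in A]inE; apply: (iffP andP) => [[Rx /forall_inP E]|[Rx E]]; split=> //.
    by move=> d Dd; exact: (eqP (E d Dd)).
  by apply/forall_inP=> d Dd; rewrite E.
have : A \subset S.
  apply: sub_Sylow_of_normalized => //.
  - by apply/subsetP=> x /AP[].
  - move=> x y /AP[Rx Ex] /AP[Ry Ey].
    apply: (moves_commute abD faithG) => //.
      by rewrite Ex ?centerD // -Ey ?centerD // moves_center.
    by rewrite Ey ?centerD // -Ex ?centerD // moves_center.
  apply/subsetP=> s /setIP[Rs Ss]; have Gs := transvectionsG Rs.
  rewrite inE; apply/subsetP=> _ /imsetP[x /AP[Rx Ex] ->].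
  have Gx := transvectionsG Rx.
  apply/AP; rewrite transvectionJ //; split=> // d Dd.
  have -> : d = to (to d s^-1) s by rewrite -act_comp ?groupV // mulVg act1.
  rewrite movesJ // Ex ?act_stable ?groupV // -(@movesJ _ _ _ _ to t s) //.
  have -> // : t ^ s = t.
  have [->|nst] := eqVneq s t; first by rewrite conjgE mulKg.
  by have [c _] := H s Rs Ss nst; apply/commute_conj.
move/subsetP/(_ r); have -> : r \in A by apply/AP.
move/(_ isT) => Sr; apply/eqP; apply: contraT => nrt; have [_ c] := H r Rr Sr nrt.
by move: tu'; rewrite -ert ?centerD // (commute_moves abD faithG Rr Ru).
Qed.

Lemma moves_act s t d : s \in R -> t \in R -> d \in D ->
  moves s (to d t) = moves s d (+) (moves s (tcenter t) && moves t d).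
Proof.
move=> Rs Rt Dd; rewrite (transvection_act abD Rt Dd).
case: (moves t d); rewrite ?expg0 ?expg1 ?mulg1 ?andbF ?addbF // andbT.
by rewrite movesM ?centerD.
Qed.

Lemma movesJ_transvection s t d : s \in R -> t \in R -> d \in D ->
  moves (s ^ t) d = moves s d (+) (moves s (tcenter t) && moves t d).
Proof.
move=> Rs Rt Dd; have [Gs Gt] := (transvectionsG Rs, transvectionsG Rt).
have {1}-> : d = to (to d t) t by rewrite -act_comp // (transvection_sq Rt) act1.
by rewrite movesJ // moves_act.
Qed.

Lemma center_conj s t : s \in R -> t \in R ->
  tcenter (s ^ t) = tcenter s * tcenter t ^+ moves t (tcenter s).
Proof.
move=> Rs Rt.
by rewrite centerJ ?(transvectionsG Rt) // (transvection_act abD Rt) ?centerD.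
Qed.

(** If only [s] moved the center of the other, [t ^ s] would have the axis of [t]; if only [t] did,
    [t ^ s] would have the center of [t]. Either way [t ^ s = t], so the two commute and neither
    center is moved. *)
Lemma moves_sym s t : t \in TT -> s \in R -> moves s (tcenter t) = moves t (tcenter s).
Proof.
move=> TTt Rs; have Rt := partneredR TTt.
have [Gs Gt] := (transvectionsG Rs, transvectionsG Rt).
case st: (moves s (tcenter t)); case ts: (moves t (tcenter s)) => //.
  have E : t ^ s = t.
    apply: axis_inj => //; first by rewrite transvectionJ.
    by move=> d Dd; rewrite movesJ_transvection // ts addbF.
  by have /commute_conj c := E; rewrite (commute_moves abD faithG Rs Rt c) in st.
have E : t ^ s = t.
  by apply: center_inj => //; rewrite ?transvectionJ // center_conj // st expg0 mulg1.
by have /commute_conj/commute_sym c := E; rewrite (commute_moves abD faithG Rt Rs c) in ts.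
Qed.

Lemma commuteE s t : t \in TT -> s \in R -> commute s t <-> moves s (tcenter t) = false.
Proof.
move=> TTt Rs; have Rt := partneredR TTt.
split=> [|E]; first exact: commute_moves.
by apply: (moves_commute abD faithG) => //; rewrite -moves_sym.
Qed.

(** Both conjugates have as center the product of the two centers and as axis map the sum of the two
    axis maps. This is the 3-transposition relation. *)
Lemma braid s t : s \in R -> t \in R -> moves s (tcenter t) -> moves t (tcenter s) ->
  s ^ t = t ^ s.
Proof.
move=> Rs Rt st ts; have [Gs Gt] := (transvectionsG Rs, transvectionsG Rt).
apply: (transvection_eq abD faithG); rewrite ?transvectionJ //.
  by rewrite !center_conj // st ts (mulDC abD) ?centerD.
by move=> d Dd; rewrite !movesJ_transvection // st ts addbC.
Qed.

(** Otherwise [braid] gives [(s * t) ^+ 3 = 1], which in a 2-group forces [s = t], although [t]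
    fixes its own center. *)
Lemma commute_in_2group (P : {group aT}) s t : 2.-group P -> s \in P -> t \in P ->
  t \in TT -> s \in R -> commute s t.
Proof.
move=> pP Ps Pt TTt Rs; have Rt := partneredR TTt.
apply/commuteE => //; case st: (moves s (tcenter t)) => //.
have ts : moves t (tcenter s) by rewrite -moves_sym.
have := braid Rs Rt st ts; rewrite !conjgE !(transvectionV Rs, transvectionV Rt) => E.
have o3 : (s * t) ^+ 3 = 1.
  have -> : (s * t) ^+ 3 = s * (t * (s * t)) * (s * t) by rewrite !expgS expg0 mulg1 !mulgA.
  rewrite E !mulgA (transvection_sq Rs) mul1g -(mulgA t s s).
  by rewrite (transvection_sq Rs) mulg1 (transvection_sq Rt).
have : coprime #[s * t] 3.
  by apply: (@pnat_coprime 2) => //; apply: mem_p_elt pP _; rewrite groupM.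
have : #[s * t] %| 3 by rewrite order_dvdn o3.
move=> /gcdn_idPl; rewrite /coprime => -> /eqP/eqP; rewrite order_eq1 => /eqP E1.
have es : s = t by rewrite -[s]mulg1 -(transvection_sq Rt) mulgA E1 mul1g.
by move: ts; rewrite es moves_center.
Qed.

(** For every Sylow subgroup [Q] containing [t], [<<R :&: Q>>] centralizes [t]. Sylow's theorem in
    the centralizer of [t] therefore moves [C], with [t] fixed, into the subgroup [S] that comes
    with the partner [u] of [t]; conjugating [u] back gives the partner sought. *)
Lemma coclique_partner (C : {set aT}) t :
  C \subset TT -> {in C &, forall x y, commute x y} -> t \in C ->
  exists2 u, u \in TT & moves u (tcenter t) /\
     forall c, c \in C -> c != t -> moves u (tcenter c) = false.
Proof.
move=> sCT cC Ct; have TTt := subsetP sCT _ Ct.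
have sCR : C \subset R by apply/subsetP=> c /(subsetP sCT)/(partneredR).
have sRG : R \subset G by apply/subsetP=> r /transvectionsG.
have Gt := partneredG TTt.
have [_ pC] := commuting_pgroup sCR cC.
have sCG : <<C>> \subset G by rewrite gen_subG (subset_trans sCR).
have [P sylP sCP] := Sylow_superset sCG pC.
have Pt : t \in P by rewrite (subsetP sCP) // mem_gen.
have cJ (Q : {group aT}) : 2.-Sylow(G) Q -> t \in Q -> <<R :&: Q>> \subset 'C_G[t].
  move=> sylQ Qt; rewrite gen_subG; apply/subsetP=> r /setIP[Rr Qr].
  rewrite inE (subsetP sRG) //=; apply/cent1P.
  exact: (commute_in_2group (pHall_pgroup sylQ) Qr Qt TTt Rr).
have /partneredP[Rt [S [u [tu [sylS St ut tu' H]]]]] := TTt.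
have pJ (Q : {group aT}) : 2.-Sylow(G) Q -> 2.-group <<R :&: Q>>.
  by move=> sylQ; apply: pgroupS (pHall_pgroup sylQ); rewrite gen_subG subsetIr.
have [S1 sylS1 sJS1] := Sylow_superset (cJ _ sylS St) (pJ _ sylS).
have [g] := Sylow_Jsub sylS1 (cJ _ sylP Pt) (pJ _ sylP).
case/setIP=> Gg /cent1P cgt sJP.
have sS1G : S1 \subset G by apply: subset_trans (pHall_sub sylS1) (subsetIl _ _).
(* [S1] is Sylow only in the centralizer and may differ from [S]; weak closure puts its
   transvections into [S] nevertheless. *)
have wc := transvections_weakly_closed sylS sS1G (pHall_pgroup sylS1) sJS1.
have tg : t ^ g = t by apply/commute_conj/commute_sym.
exists (u ^ g^-1).
  apply: partneredJ; rewrite ?groupV //.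
  by case/imsetP: tu => h Gh ->; apply: partneredJ.
have Gu : u \in G by case/imsetP: tu => h Gh ->; rewrite groupJ.
have Ru : u \in R by case/imsetP: tu => h Gh ->; rewrite transvectionJ.
split=> [|c Cc nct].
  by rewrite -[t](conjgK g) tg centerJ ?movesJ ?groupV.
have Rc := subsetP sCR _ Cc.
have Rcg : c ^ g \in R by rewrite transvectionJ.
rewrite -[c](conjgK g) centerJ ?movesJ ?groupV //.
apply: (commute_moves abD faithG) => //; apply: commute_sym.
have ncg : c ^ g != t by rewrite -{1}tg (inj_eq (conjg_inj g)).
apply: (proj2 (H _ Rcg _ ncg)).
have : c ^ g \in R :&: S1.
  rewrite inE Rcg (subsetP sJP) // memJ_conjg mem_gen // inE Rc.
  by rewrite (subsetP sCP) // mem_gen.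
by move/(subsetP wc); apply/subsetP; rewrite gen_subG subsetIr.
Qed.

End Fusion.

(** * Frames: maximal families of transpositions among the centers *)

Section Frames.

Variables (rT : finGroupType) (D : {group rT}) (X : {set rT}) (B : rT -> rT -> bool).

Hypotheses (abD : abelian D) (sXD : X \subset D).
Hypothesis X1 : 1 \notin X.
Hypothesis X2 : forall x, x \in X -> x * x = 1.
Hypothesis Bxx : forall x, x \in X -> B x x = false.
Hypothesis Bsym : {in X &, forall x y, B x y = B y x}.
Hypothesis BM : forall x, x \in X -> {in D &, {morph B x : d e / d * e >-> d (+) e}}.
Hypothesis XM : {in X &, forall x y, B x y -> x * y \in X}.
Hypothesis BMl : {in X &, forall x y, B x y -> forall d, d \in D -> B (x * y) d = B x d (+) B y d}.
Hypothesis partner : forall (C : {set rT}) x,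
  C \subset X -> {in C &, forall a b, B a b = false} -> x \in C ->
  exists2 w, w \in X & B w x /\ forall c, c \in C -> c != x -> B w c = false.

(** In the application [X] consists of the centers of partnered transvections, and [B x d] tells
    whether the one with center [x] moves [d]. The product [u i * u j] plays the transposition (i
    j); the last clause keeps disjoint transpositions from sharing a center. Indexing by [nat] lets
    a frame grow without a change of type. *)
Definition frame (m : nat) (u : nat -> rT) : Prop :=
  [/\ forall i, i < m -> u i \in D /\ u i * u i = 1,
      forall i j, i < m -> j < m -> i != j -> u i * u j \in X,
      forall i j k, i < m -> j < m -> k < m -> i != j -> j != k -> i != k ->
        B (u i * u j) (u j * u k)
    & forall i j k l, i < m -> j < m -> k < m -> l < m -> uniq [:: i; j; k; l] ->
        u i * u j != u k * u l].

Definition spanned (m : nat) (u : nat -> rT) (y : rT) : Prop :=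
  exists i j, [/\ i < m, j < m, i != j & y = u i * u j].

Let XD x : x \in X -> x \in D. Proof. exact: (subsetP sXD). Qed.

Let mulC : {in D &, commutative mulg}.
Proof. by move=> x y Dx Dy; apply: (centsP abD). Qed.

(* x, x e1 e2, x e1 e3, x e2 e3 commute pairwise and multiply to 1, so x
   cannot have a partner in this set. *)
Lemma adjacent_le2 e1 e2 e3 x :
  e1 \in X -> e2 \in X -> e3 \in X -> x \in X ->
  uniq [:: e1; e2; e3] -> B e1 e2 = false -> B e1 e3 = false -> B e2 e3 = false ->
  B x e1 -> B x e2 -> B x e3 -> False.
Proof.
move=> X1p X2p X3p Xx; rewrite /= !inE negb_or andbT => /andP[/andP[n12 n13] n23].
move=> b12 b13 b23 bx1 bx2 bx3.
have Dx := XD Xx; have D1 := XD X1p; have D2 := XD X2p; have D3 := XD X3p.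
have key a b : a \in X -> b \in X -> a != b -> B x a -> B x b -> B a b = false ->
  [/\ x * a * b \in X, x * a * b != x & forall d, d \in D -> B (x * a * b) d = B x d (+) B a d (+) B b d].
  move=> Xa Xb nab xa xb ab.
  have Xxa := XM Xx Xa xa.
  have bxab : B (x * a) b by rewrite BMl ?XD // xb ab.
  split; first exact: XM.
    rewrite -mulgA -[X in _ != X]mulg1 (inj_eq (mulgI x)).
    by apply: contraNneq nab => E; rewrite -[a]mulg1 -(X2 Xb) mulgA E mul1g.
  by move=> d Dd; rewrite BMl // BMl.
have [Xy12 ny12 B12] := key _ _ X1p X2p n12 bx1 bx2 b12.
have [Xy13 ny13 B13] := key _ _ X1p X3p n13 bx1 bx3 b13.
have [Xy23 ny23 B23] := key _ _ X2p X3p n23 bx2 bx3 b23.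
pose C := [set x; x * e1 * e2; x * e1 * e3; x * e2 * e3].
have E1 : B e1 x by rewrite Bsym.
have E2 : B e2 x by rewrite Bsym.
have E3 : B e3 x by rewrite Bsym.
have b21 : B e2 e1 = false by rewrite Bsym.
have b31 : B e3 e1 = false by rewrite Bsym.
have b32 : B e3 e2 = false by rewrite Bsym.
have sCX : C \subset X.
  by rewrite !subUset !sub1set Xx Xy12 Xy13 Xy23.
have cC : {in C &, forall a b, B a b = false}.
  move=> a b; rewrite !inE -!orbA.
  by case/or4P=> /eqP -> /or4P[] /eqP ->; rewrite ?B12 ?B13 ?B23 ?groupM // ?BM ?groupM //;
     rewrite ?Bxx // ?bx1 ?bx2 ?bx3 ?E1 ?E2 ?E3 ?b12 ?b13 ?b23 ?b21 ?b31 ?b32.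
have Cx : x \in C by rewrite !inE eqxx.
have [w Xw [wx wC]] := partner sCX cC Cx.
have := wC (x * e1 * e2); have := wC (x * e1 * e3); have := wC (x * e2 * e3).
rewrite !inE !eqxx ?orbT !BM ?groupM // wx.
move=> /(_ isT ny23) h1 /(_ isT ny13) h2 /(_ isT ny12) h3.
by move: h1 h2 h3; case: (B w e1); case: (B w e2); case: (B w e3).
Qed.

Section OneFrame.

Variables (m : nat) (u : nat -> rT).
Hypothesis fr : frame m u.

Lemma frameD i : (i < m)%N -> u i \in D. Proof. by case: fr => H _ _ _ /H[]. Qed.

Lemma frame_sq i : (i < m)%N -> u i * u i = 1. Proof. by case: fr => H _ _ _ /H[]. Qed.

Lemma frameX i j : (i < m)%N -> (j < m)%N -> i != j -> u i * u j \in X.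
Proof. by case: fr => _ H _ _; apply: H. Qed.

Lemma frameC i j : (i < m)%N -> (j < m)%N -> u i * u j = u j * u i.
Proof. by move=> im jm; apply: mulC; apply: frameD. Qed.

Lemma frame_inj i j : (i < m)%N -> (j < m)%N -> u i = u j -> i = j.
Proof.
move=> im jm E; apply/eqP; apply: contraT => nij.
by case/negP: X1; rewrite -(frame_sq jm) -{1}E frameX.
Qed.

Lemma frame_bound : (m <= #|rT|)%N.
Proof.
rewrite -[m in (m <= _)%N]card_ord.
apply: (@leq_card _ _ (fun i : 'I_m => u i)) => i j /frame_inj E.
by apply/val_inj/E.
Qed.

(** By additivity [B (u i * u j)] is known from its values on points: these are the indicator of {i,
    j} shifted by one constant [c], which cancels on a product of two points. *)
Lemma frame_pair i j k l : (i < m)%N -> (j < m)%N -> (k < m)%N -> (l < m)%N ->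
  i != j -> k != l ->
  B (u i * u j) (u k * u l) = ((k == i) (+) (k == j)) (+) ((l == i) (+) (l == j)).
Proof.
have base a b c : (a < m)%N -> (b < m)%N -> (c < m)%N -> a != b -> b != c -> a != c ->
    B (u a * u b) (u b * u c).
  by case: fr => _ _ H _; apply: H.
move=> im jm km lm nij nkl; have Xij := frameX im jm nij.
pose c := ~~ B (u i * u j) (u j).
have key h : (h < m)%N -> B (u i * u j) (u h) = (h == i) (+) (h == j) (+) c.
  move=> hm; have [->|nhj] := eqVneq h j.
    by rewrite eq_sym (negPf nij) /c; case: (B _ _).
  have [->|nhi] := eqVneq h i.
    have := Bxx Xij; rewrite BM ?frameD // /c.
    by case: (B _ _); case: (B _ _).
  have := base i j h im jm hm nij; rewrite eq_sym nhj eq_sym nhi => /(_ isT isT).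
  by rewrite BM ?frameD // /c; case: (B _ _); case: (B _ _).
rewrite BM ?frameD // !key //.
by case: (c); case: (k == i); case: (k == j); case: (l == i); case: (l == j).
Qed.

(** [B y] splits the points in two, and one side is a single point [p]. Adding the point [u p * y]
    turns [y] into the transposition of [p] with the new letter. *)
Lemma frame_extend y : y \in X -> ~ spanned m u y ->
  (exists i j, [/\ i < m, j < m & B y (u i) != B y (u j)]%N) ->
  exists u', frame m.+1 u' /\ forall i, (i < m)%N -> u' i = u i.
Proof.
move=> Xy nsy [i [j [im jm nij]]].
have Dy := XD Xy.
(* With two points on each side, i, k against j, l, the member [u i * u j] would pair nontrivially
   with the three commuting members [y], [u i * u k] and [u j * u l], against [adjacent_le2]. *)
have [p [pm Hp]] : exists p, (p < m)%N /\ forall k, (k < m)%N -> k != p -> B y (u k) != B y (u p).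
  pose alone p := [forall k : 'I_m, (nat_of_ord k != p) ==> (B y (u k) != B y (u p))].
  have alP p : reflect (forall k, (k < m)%N -> k != p -> B y (u k) != B y (u p)) (alone p).
    apply: (iffP forallP) => [H k km kp|H k]; last by apply/implyP; apply: H.
    by have /implyP := H (Ordinal km); apply.
  have nalP p : ~~ alone p -> exists2 k, (k < m)%N & k != p /\ B y (u k) = B y (u p).
    case/forallPn=> k; rewrite negb_imply negbK => /andP[kp /eqP E].
    by exists k.
  have [/alP ai|/nalP[k km [ki Ek]]] := boolP (alone i); first by exists i.
  have [/alP aj|/nalP[l lm [lj El]]] := boolP (alone j); first by exists j.
  have ij : i != j by apply: contraNneq nij => ->.
  have kj : k != j by apply: contraNneq nij => <-; rewrite Ek.
  have il : i != l by apply: contraNneq nij => ->; rewrite El.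
  have kl : k != l by apply: contraNneq nij => E; rewrite -Ek -El E.
  have [[ji jk] [li lk]] : (j != i /\ j != k) /\ (l != i /\ l != k).
    by rewrite ![_ == i]eq_sym ![_ == k]eq_sym.
  have [ik jl] : i != k /\ j != l by rewrite ![_ == k]eq_sym ![_ == l]eq_sym.
  have N := (eqxx, negPf ij, negPf ji, negPf ik, negPf ki, negPf il,
    negPf li, negPf jk, negPf kj, negPf jl, negPf lj, negPf kl, negPf lk).
  exfalso.
  have frx := frameX.
  apply: (@adjacent_le2 y (u i * u k) (u j * u l) (u i * u j)) => //.
  + exact: frx.
  + exact: frx.
  + exact: frx.
  + rewrite /= !inE negb_or andbT -andbA; apply/and3P; split.
    * by apply/eqP=> E; case: nsy; exists i, k.
    * by apply/eqP=> E; case: nsy; exists j, l.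
    * case: fr => _ _ _; apply=> //=.
      by rewrite !inE !N.
  + by rewrite BM ?frameD // Ek addbb.
  + by rewrite BM ?frameD // El addbb.
  + by rewrite frame_pair // !N.
  + rewrite Bsym ?frx // BM ?frameD //.
    by move: nij; case: (B y _); case: (B y _).
  + by rewrite frame_pair // !N.
  + by rewrite frame_pair // !N.
have yp k : (k < m)%N -> k != p -> B y (u k * u p).
  move=> km kp; rewrite BM ?frameD //; have := Hp k km kp.
  by case: (B y _); case: (B y _).
have y0 k l : (k < m)%N -> (l < m)%N -> k != p -> l != p -> B y (u k * u l) = false.
  move=> km lm kp lp; rewrite BM ?frameD //; have := Hp k km kp; have := Hp l lm lp.
  by case: (B y _); case: (B y _); case: (B y _).
have Dp := frameD pm.
pose u' k := if (k < m)%N then u k else u p * y.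
have u'E k : (k < m)%N -> u' k = u k by rewrite /u' => ->.
have u'm : u' m = u p * y by rewrite /u' ltnn.
exists u'; split=> //.
have D' k : u' k \in D.
  by rewrite /u'; case: ifP => km; rewrite ?groupM ?frameD.
have sq' k : u' k * u' k = 1.
  rewrite /u'; case: ifP => km; first exact: frame_sq.
  by rewrite mulgA -(mulgA (u p)) (mulC Dy Dp) !mulgA frame_sq // mul1g X2.
have C' k l : u' k * u' l = u' l * u' k by apply: mulC.
have lt' k : (k < m.+1)%N -> k != m -> (k < m)%N.
  by rewrite ltnS leq_eqVlt => /orP[/eqP->|//]; rewrite eqxx.
have X'm k : (k < m)%N -> u' k * u' m \in X.
  move=> km; rewrite u'm u'E // mulgA; have [->|kp] := eqVneq k p.
    by rewrite frame_sq // mul1g.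
  have Xkp := frameX km pm kp.
  by apply: XM => //; rewrite Bsym // yp.
have B'm k d : (k < m)%N -> d \in D -> B (u' k * u' m) d =
   (if k == p then false else B (u k * u p) d) (+) B y d.
  move=> km Dd; rewrite u'm u'E // mulgA; have [->|kp] := eqVneq k p.
    by rewrite frame_sq // mul1g.
  have Xkp := frameX km pm kp.
  have bkp : B (u k * u p) y by rewrite Bsym // yp.
  by rewrite (BMl Xkp Xy bkp).
have u'mp : u' m * u' p = y.
  by rewrite C' u'm u'E // mulgA frame_sq // mul1g.
have X' k l : (k < m.+1)%N -> (l < m.+1)%N -> k != l -> u' k * u' l \in X.
  move=> km lm kl; have [E|nk] := eqVneq k m.
    by rewrite E C' X'm // lt' // -E eq_sym.
  have [->|nl] := eqVneq l m; first by rewrite X'm // lt'.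
  by rewrite !u'E ?lt' // frameX // lt'.
have pair_m a b : (a < m)%N -> (b < m)%N -> a != b -> B (u' m * u' b) (u' b * u' a).
  move=> am bm ab; rewrite C' B'm // ?groupM // [u' b]u'E // [u' a]u'E //.
  have [bp|bp] := eqVneq b p.
    by rewrite bp in ab *; rewrite frameC // yp.
  have ba : b != a by rewrite eq_sym.
  rewrite frame_pair // eqxx (negPf bp) (negPf ab).
  have [ap|ap] := eqVneq a p; first by rewrite ap yp.
  by rewrite y0.
have Bymc c : (c < m)%N -> B y (u' m * u' c) = (c != p).
  move=> cm; have [->|cp] := eqVneq c p; first by rewrite u'mp Bxx.
  rewrite u'm u'E // -mulgA (mulC Dy (frameD cm)) mulgA BM ?groupM ?frameD //.
  by rewrite Bxx // addbF frameC // yp.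
(* An equality would write [y] as the product of the points b, c, a, p. If p is one of the others,
   it cancels and [y] is spanned; if not, [y] pairs with [u a * u p] both to 1 and to 0. *)
have neq_m a b c : (a < m)%N -> (b < m)%N -> (c < m)%N -> a != b -> a != c -> b != c ->
    u' m * u' a != u' b * u' c.
  move=> am bm cm ab ac bc; apply/eqP=> E.
  have Ey : y = u b * u c * (u a * u p).
    rewrite -!u'E // -E -u'mp -!mulgA; congr (_ * _).
    by rewrite mulgA sq' mul1g.
  have [ap|ap] := eqVneq a p.
    apply: nsy; exists b, c; split=> //.
    by rewrite Ey ap frame_sq // mulg1.
  have [bp|bp] := eqVneq b p.
    apply: nsy; exists c, a; rewrite eq_sym; split=> //.
    by rewrite Ey bp frameC // (frameC am) // mulgA -(mulgA (u c)) frame_sq // mulg1.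
  have [cp|cp] := eqVneq c p.
    apply: nsy; exists b, a; rewrite eq_sym; split=> //.
    by rewrite Ey cp (frameC am) // mulgA -(mulgA (u b)) frame_sq // mulg1.
  have := yp _ am ap; rewrite Bsym ?frameX // Ey BM ?frameX ?groupM ?frameD //.
  rewrite Bxx ?frameX // addbF frame_pair // eq_sym (negPf ab) (negPf bp).
  by rewrite eq_sym (negPf ac) (negPf cp).
split=> //.
  move=> a b c am bm cm ab bc ac.
  have [E|na] := eqVneq a m.
    have nb : b != m by rewrite -E eq_sym.
    have nc : c != m by rewrite -E eq_sym.
    by rewrite E pair_m ?lt' // eq_sym.
  have [E|nc] := eqVneq c m.
    have nb : b != m by rewrite -E.
    rewrite Bsym ?X' //; rewrite E C' [u' a * _]C' pair_m ?lt' //.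
  have [E|nb] := eqVneq b m.
    have am' : (a < m)%N by rewrite lt' // -E.
    have cm' : (c < m)%N by rewrite lt' // -E eq_sym.
    rewrite E B'm // ?groupM // Bymc //.
    have [ap|ap] := eqVneq a p; first by rewrite -ap eq_sym ac.
    have [cp|cp] := eqVneq c p; first by rewrite cp u'mp Bsym ?frameX // yp.
    rewrite u'm u'E // -mulgA (mulC Dy (frameD cm')) mulgA BM ?frameX ?groupM ?frameD //.
    have [pa ca] : p != a /\ c != a by rewrite eq_sym [c == a]eq_sym.
    have pc : p != c by rewrite eq_sym.
    rewrite frame_pair // eqxx (negPf pa) (negPf ca) (negPf cp).
    by rewrite Bsym ?frameX // yp.
  by rewrite !u'E ?lt' //; case: fr => _ _ H _; apply: H; rewrite ?lt'.
move=> a b c d am bm cm dm; rewrite /= !inE !negb_or andbT => /and3P[/and3P[ab ac ad] /andP[bc bd] cd].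
have [E|na] := eqVneq a m.
  by move: ab ac ad; rewrite E ![m == _]eq_sym => ? ? ?; apply: neq_m; rewrite ?lt'.
have [E|nb] := eqVneq b m.
  move: ab bc bd; rewrite E ![m == _]eq_sym => ? ? ?; rewrite C'.
  by apply: neq_m; rewrite ?lt'.
have [E|nc] := eqVneq c m.
  move: ac bc cd; rewrite E ![m == _]eq_sym => ? ? ?; rewrite eq_sym.
  by apply: neq_m; rewrite ?lt' // eq_sym.
have [E|nd] := eqVneq d m.
  move: ad bd cd; rewrite E => ? ? ?; rewrite eq_sym [u' c * _]C'.
  by apply: neq_m; rewrite ?lt' // eq_sym.
rewrite !u'E ?lt' //; case: fr => _ _ _ H; apply: H; rewrite ?lt' //.
by rewrite /= !inE !negb_or ab ac ad bc bd cd.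
Qed.

Lemma spannedP y : decidable (spanned m u y).
Proof.
case E: [exists i : 'I_m, [exists j : 'I_m, (i != j) && (y == u i * u j)]].
  left; case/existsP: E => i /existsP[j /andP[ij /eqP->]].
  by exists i, j; split=> //.
right=> -[i [j [im jm ij ey]]]; move/existsPn: E => /(_ (Ordinal im)).
by move/existsPn/(_ (Ordinal jm)); rewrite ey eqxx andbT -val_eqE ij.
Qed.

End OneFrame.

(** These are the frames to which [frame_extend] no longer applies: whatever lies outside commutes
    with all transpositions of the frame. *)
Definition complete (m : nat) (u : nat -> rT) : Prop :=
  forall y, y \in X -> ~ spanned m u y ->
  forall i j, (i < m)%N -> (j < m)%N -> B y (u i * u j) = false.

(** [n] bounds the number of extensions left, since the points are distinct elements of [rT].
    Extensions keep the old points, hence the initial transposition. *)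
Lemma frame_complete n m u : frame m u -> (1 < m)%N -> (#|rT| < m + n)%N ->
  exists m' u', [/\ frame m' u', (1 < m')%N, complete m' u' & u' 0%N * u' 1%N = u 0%N * u 1%N].
Proof.
elim: n m u => [|n IHn] m u fr m1 bd.
  by have := leq_trans bd (eq_leq (addn0 m)); rewrite ltnNge (frame_bound fr).
pose ext y := (y \in X) && [exists i : 'I_m, [exists j : 'I_m, B y (u i) != B y (u j)]] &&
  ~~ [exists i : 'I_m, [exists j : 'I_m, (i != j) && (y == u i * u j)]].
case: (pickP ext) => [y|none].
  case/andP=> /andP[Xy /existsP[i /existsP[j nij]]] nsp.
  have nsy : ~ spanned m u y.
    move=> [a [b [am bm ab ey]]]; case/existsP: nsp; exists (Ordinal am).
    by apply/existsP; exists (Ordinal bm); rewrite -val_eqE /= ab ey /=.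
  have [|u' [fr' E]] := frame_extend fr Xy nsy.
    by exists i, j.
  have [|//|m2 [u2 [fr2 m21 c2 E2]]] := IHn m.+1 u' fr'; first exact: ltnW.
    by rewrite addSnnS.
  by exists m2, u2; split=> //; rewrite E2 !E // ltnW.
exists m, u; split=> // y Xy nsy i j im jm.
rewrite BM ?(frameD fr) //; apply/eqP; rewrite -negb_eqb; apply: contraFT (none y) => nE.
rewrite /ext Xy; apply/andP; split.
  apply/existsP; exists (Ordinal im); apply/existsP; exists (Ordinal jm).
  by move: nE; case: (B y _); case: (B y _).
apply/existsP=> -[a /existsP[b /andP[ab /eqP ey]]]; case: nsy; exists a, b; split=> //.
Qed.

(** For even [m] the letters carry a perfect matching of commuting transpositions. By completeness
    the partner of the first edge is some (a b); it meets that edge in one letter only, and its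
    other letter lies on a second edge, with which it pairs too. *)
Lemma complete_odd m u : frame m u -> (1 < m)%N -> complete m u -> odd m.
Proof.
move=> fr m1 cp; apply: contraT => ev.
pose e (i : nat) := u i.*2 * u i.*2.+1.
have lt1 (i : 'I_m./2) : (i.*2 < m)%N by case: i => i /=; lia.
have lt2 (i : 'I_m./2) : (i.*2.+1 < m)%N by case: i => i /=; lia.
have ne (i : nat) : i.*2 != i.*2.+1 by apply/eqP; lia.
pose C := [set e i | i : 'I_m./2].
have h0 : (0 < m./2)%N by lia.
have sCX : C \subset X.
  by apply/subsetP=> _ /imsetP[i _ ->]; apply: (frameX fr).
have cC : {in C &, forall a b, B a b = false}.
  move=> _ _ /imsetP[i _ ->] /imsetP[j _ ->].
  rewrite (frame_pair fr) //; case: eqP; case: eqP; case: eqP; case: eqP; lia.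
have Ce (i : nat) : (i < m./2)%N -> e i \in C.
  by move=> hi; apply/imsetP; exists (Ordinal hi).
have [w Xw [we wC]] := partner sCX cC (Ce 0%N h0).
have [a [b [am bm ab ew]]] : spanned m u w.
  case: (spannedP m u w) => // /(cp w Xw)/(_ 0%N 1%N) E.
  by rewrite E ?(ltnW m1) in we.
(* The second letter is the other end of the matching edge through [c], and that edge is not the
   first one. *)
have wb c : (c < m)%N -> (1 < c)%N -> (B w (u c * u (if odd c then c.-1 else c.+1))) = false.
  move=> cm c1; have hc : (c./2 < m./2)%N by lia.
  have n0 : e c./2 != e 0%N.
    case: fr => _ _ _; apply; [lia | lia | lia | lia | rewrite /= !inE].
    lia.
  have := wC _ (Ce _ hc) n0; rewrite /e.
  case: ifP => oc.
    have -> : c./2.*2.+1 = c by lia.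
    have -> : c./2.*2 = c.-1 by lia.
    rewrite (frameC fr) //; lia.
  by have -> : c./2.*2 = c by lia.
have Wab k l : (k < m)%N -> (l < m)%N -> k != l ->
    B w (u k * u l) = ((k == a) (+) (k == b)) (+) ((l == a) (+) (l == b)).
  by move=> km lm kl; rewrite ew (frame_pair fr).
have wbb c d : (c < m)%N -> (1 < c)%N -> (d < 2)%N ->
    (forall k l, (k < m)%N -> (l < m)%N -> k != l ->
      B w (u k * u l) = ((k == c) (+) (k == d)) (+) ((l == c) (+) (l == d))) -> False.
  move=> cm c1 d2 H; have := wb c cm c1; rewrite H //; last 2 first.
  - case: ifP; lia.
  - case: ifP => _; apply/eqP; lia.
  by rewrite eqxx; case: ifP => oc; (do ! case: eqP); lia.
have := we; rewrite /e Wab //; last by lia.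
have [a2|a2] := ltnP a 2; have [b2|b2] := ltnP b 2.
- case: a b a2 b2 ab {ew am bm Wab} => [|[|a]] [|[|b]] //.
- move=> _; case: (wbb b a) => // k l km lm kl; rewrite Wab //.
  by congr (_ (+) _); rewrite addbC.
- move=> _; case: (wbb a b) => //.
- by case: eqP; case: eqP; case: eqP; case: eqP; lia.
Qed.

Theorem component_frame x : x \in X -> exists m u,
  [/\ frame m u, odd m, (2 < m)%N, complete m u & x = u 0%N * u 1%N].
Proof.
(* The points 1 and [x] form a frame on two letters; the clauses on three or four letters hold
   vacuously. *)
move=> Xx; pose u0 (i : nat) := if i is 0 then 1 else x.
have fr0 : frame 2 u0.
  split=> [[|[|i]]|[|[|i]] [|[|j]]|[|[|i]] [|[|j]] [|[|k]]|[|[|i]] [|[|j]] [|[|k]] l] //=.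
  - by rewrite mulg1.
  - by rewrite X2 // XD.
  - by rewrite mul1g.
  - by rewrite mulg1.
  - by rewrite andbF.
  - by rewrite andbF.
have [|m [u [fr m1 cp E]]] := @frame_complete #|rT| 2 u0 fr0 isT; first by lia.
have om := complete_odd fr m1 cp.
exists m, u; split=> //; last by rewrite E /u0 mul1g.
by rewrite ltn_neqAle m1 andbT; apply: contraTneq om => <-.
Qed.

End Frames.

(** * The even-weight submodule as natural module in odd degree *)

Section EvenModule.

Import GRing.Theory.
Local Open Scope ring_scope.

Variable m : nat.

Definition even_mod : 'M['F_2]_m := kermx (const_mx 1 : 'cV_m).
(** Every row is the all-ones vector, so the row space is the line of constant vectors. *)
Definition const_mod : 'M['F_2]_m := const_mx 1.

Lemma sub_even (v : 'rV['F_2]_m) : (v <= even_mod)%MS = (\sum_i v 0 i == 0).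
Proof.
apply/sub_kermxP/eqP => [/matrixP/(_ 0 0)|E].
  by rewrite !mxE => E; rewrite -[RHS]E; apply: eq_bigr => i _; rewrite !mxE mulr1.
apply/matrixP=> i j; rewrite !ord1 !mxE -[RHS]E.
by apply: eq_bigr => k _; rewrite !mxE mulr1.
Qed.

Lemma F2_cases (x : 'F_2) : x = 0 \/ x = 1.
Proof. by case: x => -[|[|//]] ?; [left|right]; apply: val_inj. Qed.

Lemma F2_add (x : 'F_2) : x + x = 0.
Proof. by rewrite -mulr2n -mulr_natr pchar_Zp ?mulr0. Qed.

Lemma rV_permE (v : 'rV['F_2]_m) (s : 'S_m) i : (v *m perm_mx s) 0 i = v 0 (s^-1 i)%g.
Proof. by rewrite -[s in perm_mx s]invgK -col_permE mxE. Qed.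

Lemma even_module : mxmodule (perm_repr m) even_mod.
Proof.
apply/mxmoduleP=> s _; apply/row_subP=> i; rewrite row_mul sub_even /=.
under eq_bigr do rewrite rV_permE.
rewrite (reindex_inj (@perm_inj _ s)) /=; under eq_bigr do rewrite permK.
by rewrite -sub_even row_sub.
Qed.

Lemma const_module : mxmodule (perm_repr m) const_mod.
Proof.
apply/mxmoduleP=> s _; apply/row_subP=> i.
suff -> : row i (const_mod *m perm_repr m s) = row i const_mod by rewrite row_sub.
by apply/rowP=> j; rewrite row_mul rV_permE !mxE.
Qed.

Lemma sub_const (v : 'rV['F_2]_m) : (v <= const_mod)%MS = [forall i, forall j, v 0 i == v 0 j].
Proof.
apply/idP/forallP => [/submxP[w ->] i|H].
  apply/forallP=> j; rewrite !mxE; apply/eqP; apply: eq_bigr => k _.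
  by rewrite !mxE.
case: (pickP 'I_m) => [k _|none]; last first.
  by rewrite (_ : v = 0) ?sub0mx //; apply/rowP=> i; have := none i.
have -> : v = v 0 k *: row k const_mod.
  apply/rowP=> i; rewrite !mxE mulr1; apply/eqP.
  by have /forallP := H i; apply.
by rewrite scalemx_sub // row_sub.
Qed.

Lemma delta_mxDD i : delta_mx 0 i + delta_mx 0 i = 0 :> 'rV['F_2]_m.
Proof. by apply/rowP=> k; rewrite !mxE F2_add. Qed.

Lemma even_decomp k (v : 'rV['F_2]_m) : (v <= even_mod)%MS ->
  v = \sum_i v 0 i *: (delta_mx 0 i + delta_mx 0 k).
Proof.
rewrite sub_even => /eqP s0; under eq_bigr do rewrite scalerDr.
by rewrite big_split /= -row_sum_delta -scaler_suml s0 scale0r addr0.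
Qed.

(** The parts above and below the diagonal are equal, so they cancel over F_2. *)
Lemma sum_symmetric (a : 'I_m -> 'I_m -> 'F_2) : (forall i j, a i j = a j i) ->
  \sum_i \sum_(j | j != i) a i j = 0.
Proof.
move=> sym.
have E i : \sum_(j | j != i) a i j =
    \sum_(j < m | (j < i)%N) a i j + \sum_(j < m | (i < j)%N) a i j.
  rewrite (bigID (fun j : 'I_m => j < i)%N) /=; congr (_ + _); apply: eq_bigl => j;
  by rewrite -val_eqE /=; case: ltngtP.
under eq_bigr do rewrite E.
rewrite big_split /= [X in _ + X](exchange_big_dep xpredT) //=.
under [X in _ + X]eq_bigr do under eq_bigr do rewrite sym.
exact: F2_add.
Qed.

Hypotheses (om : odd m) (m_gt2 : (2 < m)%N).

Lemma natr_odd : m%:R = 1 :> 'F_2.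
Proof.
rewrite -(odd_double_half m) om -muln2 natrD natrM.
by rewrite (_ : 2%:R = 0 :> 'F_2) ?mulr0 ?addr0 // pchar_Zp.
Qed.

Let i0 : 'I_m := Ordinal (ltn_trans (isT : 0 < 2)%N m_gt2).

Lemma even_const_dx : mxdirect (even_mod + const_mod).
Proof.
apply/mxdirect_addsP/eqP; rewrite -submx0; apply/rV_subP=> v.
rewrite sub_capmx sub_even sub_const => /andP[/eqP s0 /forallP H].
have E i : v 0 i = v 0 i0 by apply/eqP; have /forallP := H i; apply.
move: s0; under eq_bigr do rewrite E.
rewrite sumr_const card_ord -mulr_natr natr_odd mulr1 => v0.
by rewrite (_ : v = 0) ?sub0mx //; apply/rowP=> i; rewrite E v0 !mxE.
Qed.

(** Subtracting from [v] the constant vector whose entries are the coordinate sum of [v] leaves even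
    weight, because [m] is odd. *)
Lemma even_const_sum : (even_mod + const_mod :=: 1%:M)%MS.
Proof.
apply/eqmxP; rewrite submx1 /=; apply/rV_subP=> v _.
pose s := \sum_i v 0 i.
rewrite -[v](subrK (const_mx s)) addmx_sub_adds //.
  rewrite sub_even; under eq_bigr do rewrite !mxE.
  by rewrite big_split /= sumr_const card_ord -mulr_natr natr_odd mulr1 subrr.
by rewrite sub_const; apply/forallP=> i; apply/forallP=> j; rewrite !mxE.
Qed.

Lemma even_sub_gen (W : 'M['F_2]_m) :
  (forall i j, i != j -> ((delta_mx 0 i + delta_mx 0 j)%R : 'rV['F_2]_m) <= W)%MS ->
  (even_mod <= W)%MS.
Proof.
move=> H; apply/rV_subP=> v /(even_decomp i0)->.
apply: summx_sub => i _; apply: scalemx_sub.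
have [->|ni] := eqVneq i i0; last exact: H.
by rewrite delta_mxDD sub0mx.
Qed.

(** A larger submodule contains a vector [v] with different entries at some i and j. Adding to [v]
    its image under (i j) gives e_i + e_j, whose images under permutations generate the even
    module. *)
Lemma const_max : max_submod (perm_repr m) const_mod 1%:M.
Proof.
split.
  rewrite /ltmx submx1 /=; apply/negP => /rV_subP /(_ (delta_mx 0 i0)).
  rewrite submx1 => /(_ isT); rewrite sub_const => /forallP/(_ i0)/forallP.
  move/(_ (Ordinal (ltnW m_gt2))); rewrite !mxE !eqxx /=.
  by case: eqP.
move=> W [modW ltCW /andP[_ /negP[]]]; have /andP[sCW /row_subPn[i0' nWC]] := ltCW.
rewrite -even_const_sum addsmx_sub sCW andbT; apply: even_sub_gen.
set v := row i0' W in nWC.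
have Wv : (v <= W)%MS by apply: row_sub.
clearbody v.
have Wperm (x : 'rV_m) s : (x <= W)%MS -> (x *m perm_mx s <= W)%MS.
  move=> Wx; apply: submx_trans (submxMr _ Wx) _.
  by have /mxmoduleP/(_ s) := modW; rewrite inE; apply.
have [i [j [nij vij]]] : exists i j, i != j /\ v 0 i != v 0 j.
  move: nWC; rewrite sub_const => /forallPn[i /forallPn[j vij]].
  by exists i, j; split=> //; apply: contraNneq vij => ->.
have Wij : (((delta_mx 0 i + delta_mx 0 j)%R : 'rV['F_2]_m) <= W)%MS.
  have -> : delta_mx 0 i + delta_mx 0 j = v + v *m perm_mx (tperm i j) :> 'rV_m.
    apply/rowP=> k; rewrite [RHS]mxE rV_permE tpermV !mxE eqxx /=.
    have v1 : v 0 i + v 0 j = 1.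
      by move: vij; case: (F2_cases (v 0 i)) => ->; case: (F2_cases (v 0 j)) => ->;
        rewrite ?eqxx ?addr0 ?add0r.
    case: tpermP => [->|->|/eqP ni /eqP nj]; last by rewrite (negPf ni) (negPf nj) !F2_add.
      by rewrite eqxx (negPf nij) v1 addr0.
    by rewrite eqxx eq_sym (negPf nij) [RHS]addrC v1 add0r.
  by rewrite addmx_sub // Wperm.
move=> k l nkl.
have [s [sk sl]] : exists s : 'S_m, s i = k /\ s j = l.
  have nak : tperm i k j != k.
    by rewrite -{2}(tpermL i k) (inj_eq perm_inj) eq_sym.
  exists (tperm i k * tperm (tperm i k j) l)%g; split; rewrite permM ?tpermL //.
  by rewrite (tpermD nak) // eq_sym.
have -> : (delta_mx 0 k + delta_mx 0 l)%R = (delta_mx 0 i + delta_mx 0 j : 'rV['F_2]_m) *m perm_mx s.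
  apply/rowP=> h; rewrite rV_permE !mxE !eqxx /= -sk -sl.
  by rewrite !(canF_eq (permKV s)).
exact: Wperm.
Qed.

Lemma const_max0 : max_submod (perm_repr m) 0 const_mod.
Proof.
have nz : const_mod != 0.
  by apply/eqP => /matrixP/(_ i0 i0); rewrite !mxE; case/eqP.
split; first by rewrite lt0mx.
move=> W [_ lt0W ltWC]; have := rank_ltmx ltWC.
have : (\rank const_mod <= 1)%N.
  have -> : const_mod = (const_mx 1 : 'cV_m) *m (const_mx 1 : 'rV_m).
    by apply/matrixP=> i j; rewrite !mxE big_ord1 !mxE mulr1.
  by apply: leq_trans (mxrankM_maxl _ _) (rank_leq_col _).
move=> h1 h2; have := leq_trans h2 h1; rewrite ltnS leqn0 mxrank_eq0.
by move: lt0W; rewrite lt0mx => /negPf->.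
Qed.

Definition even_repr := submod_repr even_module.

Lemma natural_even : natural_repr even_repr.
Proof.
(* The even module complements the constants, so it is isomorphic to the top factor of this series,
   the one of index 1. *)
pose U := [:: const_mod; 1%:M].
have compU : mx_composition_series (perm_repr m) U.
  split=> [|[|[|//]] _]; rewrite /= ?const_module ?mxmodule1 //.
    exact: const_max0.
  exact: const_max.
exists U, compU, (Ordinal (isT : 1 < 2)%N); split=> //.
  have simE := mx_rsim_factmod even_module const_module even_const_sum even_const_dx.
  apply: mx_rsim_trans (mx_rsim_sym simE) _.
  apply: mx_rsim_trans (mx_rsim_sym (mx_factmod_sub const_module)) _.
  exact: section_eqmx.
(* The transposition of the letters 0 and 1 changes the even vector e_0 + e_2. *)
rewrite rker_submod; apply/eqP => /setP.
pose j1 : 'I_m := Ordinal (ltnW m_gt2).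
pose j2 : 'I_m := Ordinal m_gt2.
move=> /(_ (tperm i0 j1)); rewrite !inE /= => /eqP E.
have : (((delta_mx 0 i0 + delta_mx 0 j2)%R : 'rV['F_2]_m) <= even_mod)%MS.
  rewrite sub_even; under eq_bigr do rewrite !mxE eqxx /=.
  rewrite big_split /= (bigD1 i0) //= big1 => [|k /negPf->] //.
  by rewrite (bigD1 j2) //= [X in _ + (_ + X)]big1 => [|k /negPf->].
case/submxP=> w ew; have := congr1 (mulmx w) E; rewrite mulmxA -ew.
move/rowP/(_ i0); rewrite rV_permE tpermV tpermL !mxE !eqxx /=.
by case/eqP.
Qed.

End EvenModule.

(** * Conjugacy classes of partnered transvections as classes of transpositions *)

Section Stars.

Variables (aT rT : finGroupType) (G : {group aT}) (D : {group rT}).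
Variable to : groupAction G D.

Local Notation moves := (moves to).
Local Notation tcenter := (tcenter to).
Local Notation R := (transvections to).
Local Notation TT := (partnered to).

Hypotheses (abD : abelian D) (faithG : [faithful G, on D | to]).

(** By [center_inj] this inverts [tcenter] on [TT]; the default 1 is met only off the set of
    centers. *)
Definition of_center (x : rT) : aT := odflt 1 [pick t in TT | tcenter t == x].

Lemma of_centerK t : t \in TT -> of_center (tcenter t) = t.
Proof.
move=> TTt; rewrite /of_center; case: pickP => [s /= /andP[TTs /eqP E]|/(_ t)]; last first.
  by rewrite TTt eqxx.
by apply: (center_inj abD faithG TTt) => //; apply: partneredR.
Qed.

(* u enumerates the points of a symmetric group on m letters, of_center (u i * u j)
   being the transposition (i j); only the products u i * u j are intrinsic. *)
Definition star (m : nat) (u : 'I_m -> rT) : Prop :=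
  [/\ forall i, u i \in D /\ u i * u i = 1,
      forall i j, i != j ->
        of_center (u i * u j) \in TT /\ tcenter (of_center (u i * u j)) = u i * u j,
      forall i j k l, i != j -> k != l ->
        moves (of_center (u i * u j)) (u k * u l) =
          ((k == i) (+) (k == j)) (+) ((l == i) (+) (l == j)),
      forall i j k l, uniq [:: i; j; k; l] -> u i * u j != u k * u l
    & forall y, y \in TT -> (exists i j, i != j /\ y = of_center (u i * u j)) \/
        forall i j, moves y (u i * u j) = false].

(** The centers, paired through their transvections, satisfy the hypotheses on frames: closure under
    adjacent products is conjugation, and the partner condition is [coclique_partner]. *)
Lemma component_star t : t \in TT -> exists m (u : 'I_m -> rT),
  [/\ odd m, (2 < m)%N, star u & exists i j, i != j /\ t = of_center (u i * u j)].
Proof.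
move=> TTt.
pose X := tcenter @: TT; pose B x d := moves (of_center x) d.
have XP x : x \in X -> [/\ of_center x \in TT, of_center x \in R & tcenter (of_center x) = x].
  by case/imsetP=> s TTs ->; rewrite of_centerK //; split=> //; apply: partneredR.
have cX s : s \in TT -> tcenter s \in X by move=> TTs; apply: imset_f.
have sXD : X \subset D.
  by apply/subsetP=> _ /imsetP[s TTs ->]; rewrite centerD ?partneredR.
have X1 : 1 \notin X.
  apply/negP=> /imsetP[s /partneredR Rs E].
  by have := center_neq1 abD faithG Rs; rewrite -E eqxx.
have X2 x : x \in X -> x * x = 1.
  by case/imsetP=> s /partneredR Rs ->; apply: (center_sq abD faithG).
have Bxx x : x \in X -> B x x = false.
  by move/XP=> [_ Rx E]; rewrite /B -{2}E (moves_center abD faithG).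
have Bsym : {in X &, forall x y, B x y = B y x}.
  move=> x y /XP[Tx Rx Ex] /XP[Ty Ry Ey].
  by rewrite /B -{1}Ey -{2}Ex (moves_sym abD faithG).
have BM x : x \in X -> {in D &, {morph B x : d e / d * e >-> d (+) e}}.
  by case/XP=> Tx Rx Ex; apply: movesM.
have XMc : {in X &, forall x y, B x y -> x * y = tcenter (of_center x ^ of_center y)}.
  move=> x y Xx Xy Bxy; have [Tx Rx Ex] := XP x Xx; have [Ty Ry Ey] := XP y Xy.
  rewrite (center_conj abD faithG) // Ex Ey.
  by have := Bxy; rewrite Bsym // /B => ->.
have TTJ x y : x \in X -> y \in X -> of_center x ^ of_center y \in TT.
  move=> /XP[Tx Rx Ex] /XP[Ty Ry Ey].
  by rewrite partneredJ // (transvectionsG Ry).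
have XM : {in X &, forall x y, B x y -> x * y \in X}.
  by move=> x y Xx Xy Bxy; rewrite XMc // cX // TTJ.
have BMl : {in X &, forall x y, B x y -> forall d, d \in D -> B (x * y) d = B x d (+) B y d}.
  move=> x y Xx Xy Bxy d Dd; rewrite {1}/B XMc // of_centerK ?TTJ //.
  have [Tx Rx Ex] := XP x Xx; have [Ty Ry Ey] := XP y Xy.
  by rewrite (movesJ_transvection abD faithG) // Ey -/(B x y) Bxy.
have partner (C : {set rT}) x : C \subset X -> {in C &, forall a b, B a b = false} ->
    x \in C -> exists2 w, w \in X & B w x /\ forall c, c \in C -> c != x -> B w c = false.
  move=> sCX cC Cx; have Xx := subsetP sCX _ Cx; have [Tx Rx Ex] := XP x Xx.
  pose C' := of_center @: C.
  have sC' : C' \subset TT.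
    by apply/subsetP=> _ /imsetP[c /(subsetP sCX)/XP[Tc _ _] ->].
  have cC' : {in C' &, forall a b, commute a b}.
    move=> _ _ /imsetP[a Ca ->] /imsetP[b Cb ->].
    have [Ta Ra Ea] := XP a (subsetP sCX _ Ca); have [Tb Rb Eb] := XP b (subsetP sCX _ Cb).
    by apply/(commuteE abD faithG); rewrite // Eb; apply: cC.
  have C'x : of_center x \in C' by apply: imset_f.
  have [w TTw [wx wC]] := coclique_partner abD faithG sC' cC' C'x.
  exists (tcenter w); first exact: cX.
  rewrite /B of_centerK //; split; first by rewrite -Ex.
  move=> c Cc ncx; have [Tc Rc Ec] := XP c (subsetP sCX _ Cc).
  rewrite -Ec; apply: wC; first exact: imset_f.
  by apply: contraNneq ncx => E; rewrite -Ec E Ex.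
have [m [u [fr om m2 cp Et]]] := component_frame abD sXD X1 X2 Bxx Bsym BM XM BMl partner (cX _ TTt).
have m0 : (0 < m)%N by apply: leq_trans m2.
have m1 : (1 < m)%N by apply: leq_trans m2.
exists m, u; split=> //; last first.
  by exists (Ordinal m0), (Ordinal m1); rewrite -val_eqE -Et of_centerK.
split.
- by move=> i; rewrite (frameD fr) ?(frame_sq fr).
- by move=> i j ij; have [] // := XP (u i * u j) (frameX fr (ltn_ord i) (ltn_ord j) ij).
- by move=> i j k l ij kl; apply: (frame_pair Bxx BM fr).
- move=> i j k l; rewrite -(map_inj_uniq val_inj) => U.
  by case: fr => _ _ _; apply.
move=> y TTy; have := cp (tcenter y) (cX _ TTy); rewrite {1}/B of_centerK // => H.
case: (spannedP m u (tcenter y)) => [[i [j [im jm ij E]]]|n]; last first.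
  by right=> i j; apply: (H n i j (ltn_ord i) (ltn_ord j)).
by left; exists (Ordinal im), (Ordinal jm); rewrite -val_eqE -E of_centerK.
Qed.

(** By [braid], members that do not commute are conjugate. *)
Lemma commute_diff_class s t : s \in TT -> t \in TT -> s \notin t ^: G -> commute s t.
Proof.
move=> TTs TTt ns; have [Rs Rt] := (partneredR TTs, partneredR TTt).
have [Gs Gt] := (transvectionsG Rs, transvectionsG Rt).
apply/(commuteE abD faithG) => //; case st: (moves s (tcenter t)) => //.
case/negP: ns; have ts : moves t (tcenter s) by rewrite -(moves_sym abD faithG).
have E := braid abD faithG Rs Rt st ts.
apply/imsetP; exists (s * t^-1); first by rewrite groupM ?groupV.
by rewrite conjgM -E conjgK.
Qed.

(** In a finite group every element of [<<A>>] is a product of members of [A], so the induction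
    appends one generator at a time. *)
Lemma gen_ind (A : {set aT}) (P : aT -> Prop) :
  P 1 -> (forall x a, x \in <<A>> -> a \in A -> P x -> P (x * a)) ->
  forall x, x \in <<A>> -> P x.
Proof.
move=> P1 PM x /gen_prodgP[n [c Ac ->]]; suff [] : \prod_i c i \in <<A>> /\ P (\prod_i c i) by [].
elim: n c Ac => [|n IHn] c Ac; first by rewrite big_ord0.
rewrite big_ord_recr /=; have [g p] := IHn _ (fun i => Ac (widen_ord (leqnSn n) i)).
by split; [apply: groupM g (mem_gen (Ac _)) | apply: PM].
Qed.

Hypotheses (O2G : forall N : {group aT}, N <| G -> 2.-group N -> N :=: 1) (genG : <<TT>> = G).

(* A central element of G fixes all centers of transvections and acts trivially
   modulo the subgroup they generate, hence squares to 1. *)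
Lemma centerless : 'Z(G) = 1.
Proof.
apply: O2G; first exact: center_normal.
apply/pgroupP=> p pr_p /(Cauchy pr_p)[z Zz oz].
have [Gz cGz] := setIP Zz.
have cz h : h \in G -> commute z h by move/(centP cGz).
suff z2 : z ^+ 2 = 1 by rewrite inE -(dvdn_prime2 pr_p) // -oz order_dvdn z2.
pose W e := [/\ e \in D, e * e = 1 & to e z = e].
have W1 : W 1 by split; rewrite ?group1 ?mulg1 ?gact1.
have WM e f : W e -> W f -> W (e * f).
  move=> [De e2 ez] [Df f2 fz]; split; rewrite ?groupM //; last by rewrite gact_mul ?ez ?fz.
  by rewrite mulgA -(mulgA e) (mulDC abD Df De) !mulgA e2 mul1g f2.
have Wc t : t \in TT -> W (tcenter t).
  move=> TTt; have Rt := partneredR TTt; have Gt := transvectionsG Rt.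
  split; rewrite ?centerD ?(center_sq abD) // -centerJ //; congr tcenter.
  by apply/commute_conj/cz.
have key h : h \in <<TT>> -> forall d, d \in D -> exists2 w, W w & to d h = d * w.
  move: h; apply: gen_ind => [d Dd|h t Gh TTt IH d Dd].
    by exists 1; rewrite ?mulg1 ?act1.
  have Rt := partneredR TTt; have Gt := transvectionsG Rt; rewrite genG in Gh.
  have WX (b : bool) : W (tcenter t ^+ b) by case: b; rewrite ?expg0 ?expg1 //; apply: Wc.
  have [w [Dw w2 wz] E] := IH d Dd; rewrite act_comp // E (transvection_act abD) ?groupM //.
  exists (w * tcenter t ^+ moves t (d * w)); last by rewrite mulgA.
  by apply: WM => //; split.
apply: (faithful_eq faithG); rewrite ?groupX // => d Dd.
have [|w [Dw w2 wz] E] := key z _ d Dd; first by rewrite genG.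
by rewrite expgS expg1 act_comp // E gact_mul // E wz -mulgA w2 mulg1 act1.
Qed.

Lemma fix_partnered_eq1 g : g \in G -> (forall t, t \in TT -> commute t g) -> g = 1.
Proof.
move=> Gg H; apply/set1P; rewrite -[[set 1]]centerless inE Gg -{1}genG cent_gen.
by apply/centP=> t /H/commute_sym.
Qed.

Section OneStar.

Variables (m : nat) (u : 'I_m -> rT).
Hypotheses (om : odd m) (m_gt2 : (2 < m)%N) (stu : star u).

Local Notation tr i j := (of_center (u i * u j)).

Lemma starD i : u i \in D. Proof. by case: stu => /(_ i)[]. Qed.
Lemma star_sq i : u i * u i = 1. Proof. by case: stu => /(_ i)[]. Qed.
Lemma trTT i j : i != j -> tr i j \in TT. Proof. by case: stu => _ H _ _ _ /H[]. Qed.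
Lemma trC i j : i != j -> tcenter (tr i j) = u i * u j.
Proof. by case: stu => _ H _ _ _ /H[]. Qed.
Lemma trE i j k l : i != j -> k != l ->
  moves (tr i j) (u k * u l) = ((k == i) (+) (k == j)) (+) ((l == i) (+) (l == j)).
Proof. by case: stu => _ _ H _ _; apply: H. Qed.
Lemma trG i j : i != j -> tr i j \in G.
Proof. by move/trTT/partneredG. Qed.
Lemma trR i j : i != j -> tr i j \in R.
Proof. by move/trTT/partneredR. Qed.

Lemma tr_sym i j : tr i j = tr j i.
Proof. by rewrite (mulDC abD (starD i) (starD j)). Qed.

(** Conjugation multiplies the center by [u a * u b] exactly when the pairs share one letter, which
    exchanges a and b in it. A member of [TT] is determined by its center. *)
Lemma trJ i j a b : i != j -> a != b ->
  tr i j ^ tr a b = tr (tperm a b i) (tperm a b j).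
Proof.
move=> ij ab.
have TTc : tr i j ^ tr a b \in TT by rewrite partneredJ ?trG ?trTT.
rewrite -[LHS](of_centerK TTc) (center_conj abD faithG) ?trR // !trC // trE //.
congr of_center; have ba : b != a by rewrite eq_sym.
have ji : j != i by rewrite eq_sym.
have C x y : u x * u y = u y * u x by apply: (mulDC abD); apply: starD.
have sq x y : u x * (u x * y) = y by rewrite mulgA star_sq mul1g.
case: tpermP => [ia|ib|/eqP ia /eqP ib]; case: tpermP => [ja|jb|/eqP ja /eqP jb].
- by rewrite ia ja eqxx in ij.
- by rewrite ia jb !eqxx (negPf ab) (negPf ba) mulg1.
- by rewrite ia eqxx (negPf ab) (negPf ja) (negPf jb) expg1 (C a j) -mulgA sq C.
- by rewrite ib ja !eqxx (negPf ab) (negPf ba) mulg1.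
- by rewrite ib jb eqxx in ij.
- by rewrite ib eqxx (negPf ba) (negPf ja) (negPf jb) expg1 (C b j) (C a b) -mulgA sq C.
- by rewrite ja eqxx (negPf ab) (negPf ia) (negPf ib) expg1 -mulgA sq.
- by rewrite jb eqxx (negPf ba) (negPf ia) (negPf ib) expg1 (C a b) -mulgA sq.
by rewrite (negPf ia) (negPf ib) (negPf ja) (negPf jb) mulg1.
Qed.

(** A generator of [G] either belongs to the star, where [trJ] applies, or commutes with all of the
    star. *)
Lemma tr_conj g i j : g \in G -> i != j ->
  exists k l, k != l /\ tr i j ^ g = tr k l.
Proof.
rewrite -genG => Gg; move: g Gg i j; apply: gen_ind => [i j ij|g t Gg TTt IH i j ij].
  by exists i, j; rewrite conjg1.
have [k [l [kl E]]] := IH i j ij; rewrite conjgM E.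
case: stu => _ _ _ _ /(_ t TTt)[[a [b [ab ->]]]|H].
  by exists (tperm a b k), (tperm a b l); rewrite trJ // (inj_eq perm_inj).
exists k, l; split=> //; apply/commute_conj.
by apply/(commuteE abD faithG (trTT kl) (partneredR TTt)); rewrite trC.
Qed.

Lemma tr_step i j k : i != j -> k != j -> tr k j \in tr i j ^: G.
Proof.
move=> ij kj; have [->|ki] := eqVneq k i; first exact: class_refl.
have ik : i != k by rewrite eq_sym.
apply/imsetP; exists (tr i k); first exact: trG.
by rewrite trJ // tpermL tpermD // eq_sym.
Qed.

Lemma tr_class i j k l : i != j -> k != l -> tr k l \in tr i j ^: G.
Proof.
have T x y z : x \in y ^: G -> y \in z ^: G -> x \in z ^: G.
  by move=> xy /class_eqP <-.
move=> ij kl; have [E|kj] := eqVneq k j.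
  rewrite -E tr_sym in ij *; rewrite [tr i k]tr_sym in ij *.
  rewrite ![tr k _]tr_sym; apply: tr_step => //; by rewrite eq_sym.
apply: (T _ (tr k j)); last by rewrite tr_step.
rewrite ![tr k _]tr_sym; apply: tr_step => //; by rewrite eq_sym.
Qed.

Lemma tr_classP i j y : i != j ->
  reflect (exists k l, k != l /\ y = tr k l) (y \in tr i j ^: G).
Proof.
move=> ij; apply: (iffP idP) => [/imsetP[g Gg ->]|[k [l [kl ->]]]].
  exact: tr_conj.
exact: tr_class.
Qed.

Lemma star_inj : injective u.
Proof.
move=> i j E; apply/eqP; apply: contraT => ij.
have := center_neq1 abD faithG (trR ij).
by rewrite trC // E star_sq eqxx.
Qed.

(** A letter moved by [s] is swapped with its image. For a third letter j, either [s j = j] and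
    cancellation contradicts injectivity of [u], or i, j, [s i], [s j] are distinct and two disjoint
    transpositions would share a center. *)
Lemma tr_faithful (s : 'S_m) : (forall i j, i != j -> tr i j = tr (s i) (s j)) -> s = 1.
Proof.
move=> E; have {}E i j : i != j -> u i * u j = u (s i) * u (s j).
  by move=> ij; rewrite -trC // E // trC // (inj_eq perm_inj).
apply/permP=> i; rewrite perm1; apply/eqP; apply: contraT => si.
have C x y : u x * u y = u y * u x by apply: (mulDC abD); apply: starD.
have si' : i != s i by rewrite eq_sym.
have ssi : s (s i) = i.
  by apply/star_inj/(mulgI (u (s i))); rewrite -E // C.
have [j ji jsi] := third_point i (s i) m_gt2.
have ij : i != j by rewrite eq_sym.
have sji : s j != i by rewrite -ssi (inj_eq perm_inj).
have sjsi : s j != s i by rewrite (inj_eq perm_inj).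
have := E i j ij; have [->|sjj] := eqVneq (s j) j.
  by move/mulIg/star_inj/eqP; rewrite eq_sym (negPf si).
case: stu => _ _ _ D4 _; move/eqP; apply: contraTT => _; apply: D4.
rewrite /= !inE !negb_or ij si' [i == s j]eq_sym sji jsi [j == s j]eq_sym sjj.
by rewrite [s i == _]eq_sym sjsi.
Qed.

Variables (t : aT).
Hypothesis t_tr : exists i j, i != j /\ t = tr i j.

Local Notation H := <<t ^: G>>.

Lemma tclassP y : reflect (exists k l, k != l /\ y = tr k l) (y \in t ^: G).
Proof. by apply: (iffP idP); case: t_tr => i [j [ij ->]] => /(tr_classP _ ij). Qed.

Lemma tclassTT y : y \in t ^: G -> y \in TT.
Proof. by case/tclassP=> k [l [kl ->]]; apply: trTT. Qed.

Lemma tgenG : H \subset G.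
Proof. by rewrite gen_subG; apply/subsetP=> y /tclassTT/partneredG. Qed.

Lemma star_lift (s : 'S_m) : exists2 g, g \in H &
  forall i j, i != j -> tr i j ^ g = tr (s i) (s j).
Proof.
have [ts -> dts] := prod_tpermP s.
elim: ts dts => [|[a b] ts IH] /=.
  by move=> _; exists 1 => // i j ij; rewrite conjg1 big_nil !perm1.
case/andP=> ab /IH[g Hg E]; exists (tr a b * g).
  by rewrite groupM // mem_gen //; apply/tclassP; exists a, b.
move=> i j ij; rewrite conjgM trJ // E ?(inj_eq perm_inj) //.
by rewrite big_cons /= !permM.
Qed.

(** [g * h^-1] commutes with the class of [t] by assumption and with the other classes because it
    lies in [H]; the center of [G] being trivial, it is 1. *)
Lemma star_lift_unique g h : g \in H -> h \in H ->
  (forall i j, i != j -> tr i j ^ g = tr i j ^ h) -> g = h.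
Proof.
move=> Hg Hh E; apply/eqP; rewrite eq_mulgV1; apply/eqP.
have Hgh : g * h^-1 \in H by rewrite groupM ?groupV.
apply: fix_partnered_eq1; first exact: (subsetP tgenG).
move=> y TTy; apply/commute_sym/commute_conj.
have [/tclassP[i [j [ij ->]]]|ny] := boolP (y \in t ^: G).
  by rewrite conjgM E // conjgK.
have : g * h^-1 \in 'C[y].
  apply: subsetP Hgh; rewrite gen_subG; apply/subsetP=> x tx.
  have Tx := tclassTT tx.
  apply/cent1P; apply: commute_sym; apply: commute_diff_class => //.
  apply: contra ny => ytx; case/tclassP: tx ytx => i [j [ij ->]] /(tr_classP _ ij).
  by move/tclassP.
by move/cent1P/commute_conj.
Qed.

End OneStar.
End Stars.

(** * The symmetric group of one class and its natural module *)

Section Component.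

Import GRing.Theory.

Variables (aT rT : finGroupType) (G : {group aT}) (D : {group rT}).
Variable to : groupAction G D.

Local Notation moves := (moves to).
Local Notation tcenter := (tcenter to).
Local Notation R := (transvections to).
Local Notation TT := (partnered to).
Local Notation K := 'C_(|to)(G)%G.

Hypotheses (abD : abelian D) (faithG : [faithful G, on D | to]).
Hypotheses (O2G : forall N : {group aT}, N <| G -> 2.-group N -> N :=: 1) (genG : <<TT>> = G).

Lemma gacent_moves d t : d \in K -> t \in G -> moves t d = false.
Proof.
move=> Kd Gt; have Dd := subsetP (gacent_sub to G) _ Kd.
apply/negbTE; rewrite -gacentP //; apply: subsetP Kd.
by apply: gacentS; rewrite sub1set.
Qed.

Lemma gacent_partnered d : d \in D -> (forall t, t \in TT -> moves t d = false) -> d \in K.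
Proof.
move=> Dd H; rewrite /= gacentE // inE Dd; apply/afixP; rewrite -{1}genG.
apply: gen_ind => [|g t]; first exact: act1.
rewrite genG => Gg TTt E; rewrite act_comp ?(partneredG TTt) // E.
by have /negbFE/eqP := H t TTt.
Qed.

Lemma sub_norm_gacent : D \subset 'N(K).
Proof. exact: sub_abelian_norm (gacent_sub to G). Qed.

Lemma sub_qact_dom : G \subset qact_dom to K.
Proof.
rewrite qact_domE ?gacent_sub //.
by apply: subset_trans (acts_subnorm_gacent to (subxx G)); rewrite subsetI subxx normG.
Qed.

Lemma quotient_actE d g : d \in D -> g \in G -> (to / K)%act (coset K d) g = coset K (to d g).
Proof.
move=> Dd Gg; rewrite /= qactE //; first exact: (subsetP sub_norm_gacent).
exact: (subsetP sub_qact_dom).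
Qed.

Lemma quotient_ex (W : {group rT}) v : v \in W / K -> exists2 w, w \in W & v = coset K w.
Proof. by case/morphimP=> w _ Ww ->; exists w. Qed.

Definition center_span (C : {set aT}) : {group rT} := [group of <<tcenter @: C>>].

Lemma center_span_sub (C : {set aT}) : C \subset TT -> center_span C \subset D.
Proof.
move=> sC; rewrite gen_subG; apply/subsetP=> _ /imsetP[c /(subsetP sC) TTc ->].
by rewrite centerD // partneredR.
Qed.

Lemma center_span_act (C : {set aT}) g : C \subset TT -> g \in G -> g \in 'N(C) ->
  {in center_span C, forall w, to w g \in center_span C}.
Proof.
move=> sC Gg nCg w; have sW := center_span_sub sC; move: w; apply: gen_ind => [|w a Ww].
  by rewrite gact1 // group1.
case/imsetP=> c Cc -> IH; have TTc := subsetP sC _ Cc.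
rewrite gact_mul ?(subsetP sW) //; last by rewrite mem_gen // imset_f.
rewrite groupM // -centerJ ?partneredR // mem_gen // imset_f //.
by rewrite memJ_norm.
Qed.

Lemma fix_center_span (C : {set aT}) g : C \subset TT -> g \in G ->
  (forall c, c \in C -> commute c g) -> {in center_span C, forall w, to w g = w}.
Proof.
move=> sC Gg cg w Ww; have Dw := subsetP (center_span_sub sC) _ Ww.
suff : w \in 'C_(|to)[g] by rewrite gacentP // negbK => /eqP.
apply: subsetP Ww; rewrite gen_subG; apply/subsetP=> _ /imsetP[c Cc ->].
have TTc := subsetP sC _ Cc; have Rc := partneredR TTc.
rewrite gacentP ?centerD // negbK -centerJ //.
by apply/eqP; congr tcenter; apply/commute_conj/commute_sym/cg.
Qed.

Variables (m : nat) (u : 'I_m -> rT) (t : aT).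
Hypotheses (om : odd m) (m_gt2 : (2 < m)%N) (stu : star to u).

Local Notation tr i j := (of_center to (u i * u j)).
Hypothesis t_tr : exists i j, i != j /\ t = tr i j.

Local Notation C := (t ^: G).
Local Notation H := <<t ^: G>>%G.

(** Existence is [star_lift], so the default is never taken; uniqueness is [star_lift_unique], which
    makes the map a morphism. *)
Definition star_perm (s : 'S_m) : aT :=
  odflt 1 [pick g in H | [forall i, forall j, (i != j) ==> (tr i j ^ g == tr (s i) (s j))]].

Lemma star_permP s : star_perm s \in H /\ forall i j, i != j -> tr i j ^ star_perm s = tr (s i) (s j).
Proof.
rewrite /star_perm; case: pickP => [g /andP[Hg /forallP E]|no].
  split=> // i j ij; have /forallP/(_ j) := E i.
  by rewrite ij => /eqP.
have [g Hg E] := star_lift abD faithG genG stu t_tr s.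
case/negP: (no g); rewrite Hg /=; apply/forallP=> i; apply/forallP=> j.
by apply/implyP=> ij; rewrite E.
Qed.

Lemma star_permM : {in [set: 'S_m] &, {morph star_perm : x y / x * y}}.
Proof.
move=> s r _ _; have [Hs Es] := star_permP s; have [Hr Er] := star_permP r.
have [Hsr Esr] := star_permP (s * r).
apply: (star_lift_unique abD faithG O2G genG stu t_tr) => //; first exact: groupM.
move=> i j ij; rewrite Esr // conjgM Es // Er ?(inj_eq perm_inj) //.
by rewrite !permM.
Qed.

Definition star_morphism := Morphism star_permM.

Lemma star_tperm a b : a != b -> star_perm (tperm a b) = tr a b.
Proof.
move=> ab; have [Hs Es] := star_permP (tperm a b).
apply: (star_lift_unique abD faithG O2G genG stu t_tr) => //.
  by apply: mem_gen; apply/(tclassP abD faithG genG stu t_tr); exists a, b.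
by move=> i j ij; rewrite Es // (trJ abD faithG stu).
Qed.

Lemma star_isom : isom [set: 'S_m] H star_morphism.
Proof.
apply/isomP; split.
  apply/injmP => s r _ _ E; apply/eqP; rewrite eq_mulgV1; apply/eqP.
  apply: (tr_faithful abD faithG m_gt2 stu) => i j ij.
  have [_ <-] // := star_permP (s * r^-1).
  have -> : star_perm (s * r^-1) = 1.
    have /= -> := morphM star_morphism (in_setT s) (in_setT r^-1).
    have /= -> := morphV star_morphism (in_setT r).
    by have /= -> := E; rewrite mulgV.
  by rewrite conjg1.
apply/eqP; rewrite eqEsubset; apply/andP; split.
  by apply/subsetP=> _ /morphimP[s _ _ ->]; have [] := star_permP s.
rewrite gen_subG; apply/subsetP=> y /(tclassP abD faithG genG stu t_tr)[a [b [ab ->]]].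
by rewrite -star_tperm //; apply: (mem_morphim star_morphism); rewrite inE.
Qed.

(** * Coordinates on [D] read off from the pairing *)

Local Open Scope ring_scope.

(** If each [tr i j] pairs with [d] to v_i + v_j for an even-weight vector v, then the sum over j !=
    i is v_i, because [m] is odd. *)
Definition coord (d : rT) : 'rV['F_2]_m :=
  \row_i \sum_(j < m | j != i) (moves (tr i j) d)%:R.

Let trG' i j : i != j -> tr i j \in G. Proof. exact: trG. Qed.
Let trR' i j : i != j -> tr i j \in R. Proof. exact: trR. Qed.

Lemma F2_addb (a b : bool) : (a (+) b)%:R = a%:R + b%:R :> 'F_2.
Proof. by case: a; case: b; rewrite ?addr0 ?add0r ?F2_add. Qed.

Lemma coordM d e : d \in D -> e \in D -> coord (d * e)%g = coord d + coord e.
Proof.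
move=> Dd De; apply/rowP=> i; rewrite !mxE -big_split /=.
by apply: eq_bigr => j ji; rewrite movesM ?F2_addb // trR' // eq_sym.
Qed.

Lemma coord_even d : (coord d <= even_mod m)%MS.
Proof.
rewrite sub_even; under eq_bigr do rewrite mxE.
by rewrite (sum_symmetric (a := fun i j => (moves (tr i j) d)%:R)) // => i j; rewrite tr_sym.
Qed.

Lemma moves_tr3 d i j k : d \in D -> i != j -> j != k -> i != k ->
  moves (tr i j) d = moves (tr i k) d (+) moves (tr j k) d.
Proof.
move=> Dd ij jk ik; have kj : k != j by rewrite eq_sym.
have -> : tr i j = (tr i k ^ tr k j)%g.
  by rewrite (trJ abD faithG stu) // tpermL tpermD // eq_sym.
rewrite (movesJ_transvection abD faithG) ?trR' // (trC stu) // (trE stu) //.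
have [ki ji] : k != i /\ j != i by rewrite ![_ == i]eq_sym.
by rewrite eqxx (negPf ki) (negPf ji) (negPf jk) /= (tr_sym abD stu j k).
Qed.

Lemma sumD1_odd (f : 'I_m -> 'F_2) i : \sum_(j | j != i) f j = \sum_j f j + f i.
Proof. by rewrite [in RHS](bigD1 i) //= addrAC F2_add add0r. Qed.

Lemma sum_const_odd (c : 'F_2) : \sum_(j < m) c = c.
Proof. by rewrite sumr_const card_ord -mulr_natr natr_odd // mulr1. Qed.

(** The common term of the two sums cancels. By [moves_tr3] each of the [m - 2] remaining letters
    contributes the pairing of [tr i j] with [d], and [m - 2] is odd. *)
Lemma coordD d i j : d \in D -> i != j -> coord d 0 i + coord d 0 j = (moves (tr i j) d)%:R.
Proof.
move=> Dd ij; rewrite !mxE; have ji : j != i by rewrite eq_sym.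
rewrite (bigD1 j) //= [X in _ + X](bigD1 i) //= (tr_sym abD stu j i).
rewrite addrACA F2_add add0r.
have E k : (k != j) && (k != i) = (k != i) && (k != j) by rewrite andbC.
under [X in _ + X]eq_bigl do rewrite E.
rewrite -big_split /=; set c := (moves (tr i j) d)%:R.
transitivity (\sum_(k | (k != i) && (k != j)) c).
  apply: eq_bigr => k /andP[ki kj]; rewrite -F2_addb -moves_tr3 //; by rewrite eq_sym.
have := sum_const_odd c; rewrite (bigD1 i) //= (bigD1 j) //= addrA F2_add add0r.
by [].
Qed.

Lemma coord_tr a b : a != b -> coord (u a * u b)%g = delta_mx 0 a + delta_mx 0 b.
Proof.
move=> ab; apply/rowP=> i; rewrite !mxE eqxx /=.
pose f (j : 'I_m) : 'F_2 := ((i == a)%:R + (i == b)%:R) + ((j == a)%:R + (j == b)%:R).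
transitivity (\sum_(j | j != i) f j).
  apply: eq_bigr => j ji; rewrite (trE stu) //; last by rewrite eq_sym.
  rewrite !F2_addb /f ![a == _]eq_sym ![b == _]eq_sym.
  by rewrite addrACA.
have one k : \sum_j (j == k)%:R = 1 :> 'F_2.
  by rewrite (bigD1 k) //= eqxx big1 ?addr0 // => j /negPf->.
by rewrite sumD1_odd /f F2_add addr0 big_split /= sum_const_odd big_split /= !one F2_add addr0.
Qed.

Lemma coord_act d s : d \in D -> coord (to d (star_perm s)) = coord d *m perm_mx s.
Proof.
move=> Dd; have [Hs Es] := star_permP s.
have Gs : star_perm s \in G by apply: subsetP Hs; apply: (tgenG abD faithG genG stu t_tr).
apply/rowP=> i; rewrite rV_permE !mxE (reindex_inj (@perm_inj _ s)) /=.
rewrite -{1}(permKV s i); under eq_bigl do rewrite (inj_eq perm_inj).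
apply: eq_bigr => j ji; congr (nat_of_bool _)%:R.
by rewrite -{1}(permKV s i) -Es 1?eq_sym // movesJ // trG' // eq_sym.
Qed.

Lemma coord0 d : d \in D -> coord d = 0 -> forall y, y \in C -> moves y d = false.
Proof.
move=> Dd d0 y /(tclassP abD faithG genG stu t_tr)[i [j [ij ->]]].
have := coordD Dd ij; rewrite d0 !mxE addr0.
by case: (moves _ _) => // /esym/eqP.
Qed.

Lemma coord1 : coord 1%g = 0.
Proof.
have := coordM (group1 D) (group1 D); rewrite mulg1 => /eqP.
by rewrite -subr_eq0 opprD addrA subrr add0r oppr_eq0 => /eqP.
Qed.

Lemma coord_surj (v : 'rV['F_2]_m) : (v <= even_mod m)%MS ->
  exists2 w, w \in center_span C & coord w = v.
Proof.
have sC : C \subset TT by apply/subsetP; apply: (tclassTT abD faithG genG stu t_tr).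
have WD := subsetP (center_span_sub sC).
pose i0 : 'I_m := Ordinal (ltnW (ltnW m_gt2)).
move/(even_decomp i0)->; elim/big_ind: _ => [|x y [w Ww <-] [w' Ww' <-]|i _].
- by exists 1%g; rewrite ?coord1.
- by exists (w * w')%g; rewrite ?groupM ?coordM ?WD.
case: (F2_cases (v 0 i)) => ->.
  by exists 1%g; rewrite ?scale0r ?coord1.
have [->|ni] := eqVneq i i0; first by exists 1%g; rewrite ?delta_mxDD ?scaler0 ?coord1.
exists (u i * u i0)%g; last by rewrite coord_tr // scale1r.
rewrite mem_gen // -(trC stu) // imset_f //.
by apply/(tclassP abD faithG genG stu t_tr); exists i, i0.
Qed.

Local Open Scope group_scope.

Lemma class_sub : C \subset TT.
Proof. by apply/subsetP; apply: (tclassTT abD faithG genG stu t_tr). Qed.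

(** The coordinates are rewritten in the basis of [even_mod m] on which [even_repr] acts. *)
Definition even_coord (d : rT) : 'rV['F_2]_(\rank (even_mod m)) := in_submod (even_mod m) (coord d).

Lemma even_coordM : {in D &, {morph even_coord : d e / (d * e)%g >-> (d * e)%g}}.
Proof. by move=> d e Dd De; rewrite /even_coord coordM // linearD. Qed.

Lemma even_coordK d : val_submod (even_coord d) = coord d.
Proof. by rewrite in_submodK ?coord_even. Qed.

Lemma even_coord0 d : (even_coord d == 0%R) = (coord d == 0%R).
Proof. by rewrite -even_coordK val_submod_eq0. Qed.

Definition even_coord_morphism := Morphism even_coordM.

Lemma ker_even_coord : 'ker (coset K) \subset 'ker even_coord_morphism.
Proof.
rewrite ker_coset; apply/subsetP=> d Kd; have Dd := subsetP (gacent_sub to G) _ Kd.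
apply/kerP => //=; apply/eqP; rewrite even_coord0; apply/eqP/rowP=> i; rewrite !mxE.
by apply: big1 => j ji; rewrite gacent_moves // trG' // eq_sym.
Qed.

Lemma center_span_quo : center_span C / K \subset D / K.
Proof. by rewrite quotientS // center_span_sub // class_sub. Qed.

Lemma mem_quotient_span w : w \in center_span C -> coset K w \in center_span C / K.
Proof.
by move=> Ww; rewrite mem_quotient.
Qed.

Definition quo_coord := restrm center_span_quo (factm ker_even_coord sub_norm_gacent).

Lemma quo_coordE w : w \in center_span C -> quo_coord (coset K w) = even_coord w.
Proof.
move=> Ww; apply: (factmE ker_even_coord sub_norm_gacent).
exact: (subsetP (center_span_sub class_sub)).
Qed.

(* Centers of transvections outside the class are killed, so an element of the
   span moved by no transvection of the class is fixed by G. *)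
Lemma span_gacent w : w \in center_span C -> (forall y, y \in C -> moves y w = false) -> w \in K.
Proof.
move=> Ww H0; have Dw := subsetP (center_span_sub class_sub) _ Ww.
apply: gacent_partnered => // y TTy; have [/H0 //|ny] := boolP (y \in C).
have cy c : c \in C -> commute c y.
  move=> Cc; apply: (commute_diff_class abD faithG) => //; first exact: (subsetP class_sub _ Cc).
  by apply: contra ny => /class_eqP E; move/class_eqP: Cc => <-; rewrite E class_refl.
by rewrite /moves (fix_center_span class_sub (partneredG TTy) cy) ?eqxx.
Qed.

(** An element of the span with zero coordinates is moved by no member of the class, hence lies in
    [K] by [span_gacent]; surjectivity is [coord_surj]. *)
Lemma quo_coord_isom :
  isom (center_span C / K) [set: 'rV['F_2]_(\rank (even_mod m))] quo_coord.
Proof.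
have WD := subsetP (center_span_sub class_sub).
apply/isomP; split.
  apply/subsetP=> v /morphpreP[/quotient_ex[w Ww ->]].
  move/set1P=> E; have /eqP := etrans (esym (quo_coordE Ww)) E.
  rewrite even_coord0 => /eqP c0.
  by apply/set1P; apply: coset_id; apply: span_gacent => //; apply: coord0 => //; apply: WD.
apply/eqP; rewrite eqEsubset subsetT; apply/subsetP=> x _.
have [w Ww Ew] := coord_surj (val_submodP x).
rewrite -[x]val_submodK -Ew -/(even_coord w) -quo_coordE //.
by rewrite mem_morphim ?mem_quotient_span.
Qed.

Lemma natural_component : natural_module (to / K) H (center_span C / K)%G m.
Proof.
have WD := subsetP (center_span_sub class_sub).
split=> //; exists star_morphism; split; first exact: star_isom.
exists (\rank (even_mod m)), (even_repr m), [morphism of quo_coord]; split.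
- exact: natural_even.
- exact: quo_coord_isom.
move=> _ /quotient_ex[w Ww ->] s; have [Hs Es] := star_permP s.
have Gs : star_perm s \in G by apply: subsetP Hs; apply: (tgenG abD faithG genG stu t_tr).
have Wws : to w (star_perm s) \in center_span C.
  by apply: center_span_act => //; [exact: class_sub | exact: (subsetP (class_norm t G))].
rewrite quotient_actE ?WD //; split; first exact: mem_quotient_span.
change (quo_coord (coset K (to w (star_perm s))) = (quo_coord (coset K w) *m even_repr m s)%R).
rewrite !quo_coordE //.
apply: val_submod_inj; rewrite val_submodJ ?inE // !even_coordK.
by rewrite coord_act ?WD.
Qed.

(** By [coordD] the coordinates determine the pairings with the class, so an element of the span
    with the coordinates of [d] will do. This is what makes the spans exhaust [D] modulo [K]. *)
Lemma span_complement d : d \in D ->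
  exists2 w, w \in center_span C & forall y, y \in C -> moves y w = moves y d.
Proof.
move=> Dd; have WD := subsetP (center_span_sub class_sub).
have [w Ww E] := coord_surj (coord_even d); exists w => //.
move=> y /(tclassP abD faithG genG stu t_tr)[i [j [ij ->]]].
have := coordD Dd ij; rewrite -E coordD ?WD //.
by case: (moves _ w); case: (moves _ d) => // /eqP.
Qed.

End Component.

(** * Assembling the classes into direct products *)

Lemma component_natural (aT rT : finGroupType) (G : {group aT}) (D : {group rT})
    (to : groupAction G D) :
  abelian D -> [faithful G, on D | to] ->
  (forall N : {group aT}, N <| G -> 2.-group N -> N :=: 1) ->
  <<partnered to>> = G ->
  forall t, t \in partnered to -> exists m,
    [/\ odd m, <<t ^: G>> \isog [set: 'S_m],
        natural_module (to / 'C_(|to)(G)) <<t ^: G>>%G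
           (center_span to (t ^: G) / 'C_(|to)(G))%G m
      & forall d, d \in D -> exists2 w, w \in center_span to (t ^: G) &
          forall y, y \in t ^: G -> moves to y w = moves to y d].
Proof.
move=> abD faithG O2G genG t TTt.
have [m [u [om m2 stu t_tr]]] := component_star abD faithG TTt.
exists m; split=> //.
- by rewrite isog_sym; apply: isom_isog (star_isom abD faithG O2G genG m2 stu t_tr).
- exact: natural_component stu t_tr.
by move=> d Dd; apply: (span_complement abD faithG genG om m2 stu t_tr).
Qed.

Theorem theorem1p4 (aT rT : finGroupType) (G : {group aT}) (D : {group rT})
    (to : groupAction G D) :
  abelian D -> 2.-group D -> [faithful G, on D | to] ->
  (forall N : {group aT}, N <| G -> 2.-group N -> N :=: 1) ->
  gen_groups (solitary_offenders to) = G ->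
  exists (k : nat) (m : 'I_k -> nat) (H : 'I_k -> {group aT})
         (V : 'I_k -> {group coset_of 'C_(|to)(G)}),
    [/\ \big[dprod/1]_(i < k) H i = G,
        forall i, odd (m i) /\ H i \isog [set: 'S_(m i)],
        \big[dprod/1]_(i < k) V i = D / 'C_(|to)(G),
        forall i, natural_module (to / 'C_(|to)(G)) (H i) (V i) (m i)
      & forall i j, i != j -> H j \subset 'C(V i | to / 'C_(|to)(G))].
Proof.
move=> abD _ faithG O2G defG; pose TT := partnered to; pose K := 'C_(|to)(G)%G.
have sTTG : TT \subset G by apply/subsetP=> t /partneredG.
have genG : <<TT>> = G.
  apply/eqP; rewrite eqEsubset gen_subG sTTG -{1}defG gen_subG.
  apply/bigcupsP=> T /(solitary_partnered abD faithG)[t TTt ->].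
  by rewrite cycle_subG mem_gen.
(* The factors are indexed by the conjugacy classes of partnered transvections. *)
pose CC := [set t ^: G | t in TT].
pose C (i : 'I_#|CC|) : {set aT} := enum_val i.
have CP i : exists2 t, t \in TT & C i = t ^: G by apply/imsetP/enum_valP.
have inC t : t \in TT -> exists i, t \in C i.
  move=> TTt; have CCt : t ^: G \in CC by apply: imset_f.
  by exists (enum_rank_in CCt (t ^: G)); rewrite /C enum_rankK_in ?class_refl.
have sCTT i : C i \subset TT.
  have [t TTt ->] := CP i; apply/subsetP=> _ /imsetP[g Gg ->].
  exact: partneredJ.
have classC i y : y \in C i -> C i = y ^: G.
  by have [t _ ->] := CP i => /class_eqP.
have sCG i : C i \subset G := subset_trans (sCTT i) sTTG.
have cC i j x y : i != j -> x \in C i -> y \in C j -> commute x y.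
  move=> ij Cx Cy; apply: (commute_diff_class abD faithG).
  - exact: subsetP (sCTT i) _ Cx.
  - exact: subsetP (sCTT j) _ Cy.
  apply: contra ij => xy; apply/eqP/enum_val_inj.
  by rewrite -/(C i) -/(C j) (classC _ _ Cx) (classC _ _ Cy); apply/class_eqP.
pose H i := <<C i>>%G; pose W i := center_span to (C i); pose V i := (W i / K)%G.
have comp i : exists m, [/\ odd m, H i \isog [set: 'S_m],
      natural_module (to / K) (H i) (V i) m
    & forall d, d \in D -> exists2 w, w \in W i &
          forall y, y \in C i -> moves to y w = moves to y d].
  have [t TTt E] := CP i; rewrite /V /W /H E.
  exact: component_natural.
have {comp} [m Hm] := fin_all_exists comp.
have sWD i : W i \subset D := center_span_sub abD faithG (sCTT i).
have WD i w : w \in W i -> w \in D by apply/subsetP.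
have fixW i j y w : i != j -> y \in C j -> w \in W i -> moves to y w = false.
  move=> ij Cy Ww; rewrite /moves (fix_center_span abD faithG (sCTT i)) ?eqxx //.
    exact: subsetP (sCG j) _ Cy.
  by move=> c Cc; apply: (cC i j).
have RTT y : y \in TT -> y \in transvections to by apply: partneredR.
have nKD := sub_norm_gacent to abD.
exists #|CC|, m, H, V; split.
- have cH i : (\prod_(j | true && (j != i)) H j)%G \subset 'C(H i).
    rewrite bigprodGE gen_subG; apply/bigcupsP=> j ji; rewrite gen_subG /H /= cent_gen.
    by apply/subsetP=> y Cy; apply/centP=> x Cx; apply: (cC j i).
  have /eqP -> : \big[dprod/1]_i H i == (\prod_i H i)%G.
    apply/bigdprodYP=> i _; rewrite subsetD cH /=.
    apply/pred0P=> x /=; apply/negbTE/negP=> /andP[Px]; rewrite in_setD1 => /andP[nx Hx].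
    (* An element of [H i] in the product of the other factors commutes with [C i] through that
       product, and with every other class through [H i]. *)
    case/eqP: nx; apply: (fix_partnered_eq1 abD faithG O2G genG).
      by apply: subsetP Hx; rewrite gen_subG.
    move=> y /inC[l Cy]; have [li|li] := eqVneq l i.
      move/subsetP/(_ x Px)/centP: (cH i) => cx; apply: commute_sym; apply: cx.
      by rewrite -li mem_gen.
    have : H i \subset 'C[y].
      rewrite gen_subG; apply/subsetP=> z Cz; apply/cent1P.
      by apply: (cC i l) => //; rewrite eq_sym.
    by move/subsetP/(_ x Hx)/cent1P/commute_sym.
  apply/eqP; rewrite bigprodGE eqEsubset; apply/andP; split.
    by rewrite gen_subG; apply/bigcupsP=> i _; rewrite gen_subG.
  rewrite -{1}genG genS //; apply/subsetP=> y /inC[l Cy]; apply/bigcupP; exists l => //.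
  exact: mem_gen.
- by move=> i; have [] := Hm i.
- have cV i j : V i \subset 'C(V j).
    apply: (centSS _ _ (quotient_abelian K abD)); exact: quotientS.
  have /eqP -> : \big[dprod/1]_i V i == (\prod_i V i)%G.
    apply/bigdprodYP=> i _; rewrite subsetD; apply/andP; split.
      by rewrite bigprodGE gen_subG; apply/bigcupsP=> j ji; apply: cV.
    apply/pred0P=> x /=; apply/negbTE/negP=> /andP[Px]; rewrite in_setD1 => /andP[nx Vx].
    case/eqP: nx.
    (* The product of the other factors lifts to elements of [D] that [C i] does not move. *)
    have key z : z \in <<\bigcup_(j | true && (j != i)) V j>> -> exists w,
        [/\ w \in D, z = coset K w & forall y, y \in C i -> moves to y w = false].
      move: z; apply: gen_ind => [|z a Gz /bigcupP[j ji /quotient_ex[w' Ww' ->]] [w [Dw -> fw]]].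
        exists 1; split; rewrite ?morph1 // => y Cy.
        by apply: moves1; apply: (subsetP (sCG i)).
      have Dw' := WD _ _ Ww'.
      exists (w * w'); split; rewrite ?groupM ?morphM ?(subsetP nKD) //.
      move=> y Cy; rewrite movesM ?fw ?(fixW j i) //.
      exact/RTT/(subsetP (sCTT i)).
    have [|w' [Dw' xw' fw']] := key x; first by rewrite -bigprodGE.
    case/quotient_ex: Vx => w Ww xw; have Dw := WD _ _ Ww.
    (* Modulo [K], [w] equals such a lift, so [C i] fixes it; the other classes fix it because it
       lies in [W i]. Hence [w] is in [K]. *)
    have : w \in K :* w' by apply/rcoset_kercosetP; rewrite ?(subsetP nKD) // -xw.
    case/rcosetP=> k Kk Ew; have Dk := subsetP (gacent_sub to G) _ Kk.
    rewrite xw; apply: coset_id; apply: (gacent_partnered genG) => // y TTy.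
    have [l Cy] := inC y TTy; have [li|li] := eqVneq l i; last by rewrite (fixW i l) // eq_sym.
    rewrite Ew movesM ?RTT // fw' -?li // addbF.
    exact: gacent_moves Kk (subsetP sTTG _ TTy).
  apply/eqP; rewrite bigprodGE eqEsubset; apply/andP; split.
    by rewrite gen_subG; apply/bigcupsP=> i _; apply: quotientS.
  apply/subsetP=> _ /morphimP[d _ Dd ->].
  (* On [C l] only [w l] contributes to the pairing with the product of the [w i], and it agrees
     with [d] there; so [d] and the product differ by an element of [K]. *)
  have ex i : exists w, w \in W i /\ forall y, y \in C i -> moves to y w = moves to y d.
    by have [_ _ _ /(_ d Dd)[w Ww E]] := Hm i; exists w.
  have [w Hw] := fin_all_exists ex.
  set VV := <<_>>; have VVg i : V i \subset VV by rewrite sub_gen // (bigcup_max i).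
  have [Dp Vp] : \prod_i w i \in D /\ coset K (\prod_i w i) \in VV.
    elim/big_ind: _ => [|x y [Dx Vx] [Dy Vy]|i _].
    - by rewrite morph1 !group1.
    - by rewrite morphM ?groupM ?(subsetP nKD).
    have [Ww _] := Hw i; split; first exact: WD Ww.
    by rewrite (subsetP (VVg i)) // mem_quotient.
  have Kd : d * (\prod_i w i)^-1 \in K.
    apply: (gacent_partnered genG); first by rewrite groupM ?groupV.
    move=> y TTy; have Ry := RTT y TTy; have [l Cy] := inC y TTy.
    have [_ E] : \prod_i w i \in D /\ moves to y (\prod_i w i) = \big[addb/false]_i moves to y (w i).
      elim/big_ind2: _ => [|x1 b1 x2 b2 [D1 E1] [D2 E2]|i _].
      - by rewrite group1 moves1 // (subsetP sTTG).
      - by rewrite groupM // movesM // E1 E2.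
      by have [/WD] := Hw i.
    rewrite movesM ?groupV // -[moves to y _^-1]addFb.
    have := movesM Ry Dp (groupVr Dp); rewrite mulgV moves1 ?(subsetP sTTG) // E.
    rewrite (bigD1 l) //= big1 => [|i il]; last first.
      by have [Ww _] := Hw i; rewrite (fixW i l).
    have [_ ->//] := Hw l.
    by case: (moves to y d); case: (moves to y _^-1).
  suff E : coset K d = coset K (\prod_i w i) by rewrite -E in Vp.
  by apply/rcoset_kercosetP; rewrite ?(subsetP nKD) // mem_rcoset.
- by move=> i; have [] := Hm i.
move=> i j ij; rewrite gen_subG; apply/subsetP=> y Cy; have Gy := subsetP (sCG j) _ Cy.
rewrite in_setI (subsetP (sub_qact_dom to)) //= inE.
apply/subsetP=> _ /quotient_ex[w Ww ->]; rewrite inE.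
rewrite quotient_actE //; last exact: WD Ww.
by have /negbFE/eqP -> := fixW i j y w ij Cy Ww.
Qed.
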